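(* $\mathsf{AST}\in\Pi^0_2$.
   Context: pGCL. Fix a countable set $\mathrm{Var}$ of variables taking rational values. Programs are generated by $P ::= \bot \mid v:=e \mid P;P \mid P\oplus_p P \mid P\,[\!]\,P \mid \mathtt{while}(b)\{P\}$ ($v\in\mathrm{Var}$, $e,p$ arithmetical expressions, $b$ boolean expression, $\bot$ the empty program; $\oplus_p$ probabilistic choice, $[\!]$ nondeterministic choice). A valuation is $\eta:\mathrm{Var}\to\mathbb{Q}$. A scheduler is a total function $f:\{L_n,R_n,L_p,R_p\}^*\to\{L_n,R_n\}$; $\mathbb{F}$ is the set of schedulers. An execution state is $(P,\eta,a,w)$ with $a\in\mathbb{Q}\cap(0,1]$, $w\in\{L_n,R_n,L_p,R_p\}^*$; states with program $\bot$ are terminal. For $f\in\mathbb{F}$, $\to_f$ is the smallest relation with: $(v:=e,\eta,a,w)\to_f(\bot,\eta[v\mapsto[\![e]\!]_\eta],a,w)$; if $(P_1,\eta,a,w)\to_f(P_1',\eta',a',w')$ then $(P_1;P_2,\eta,a,w)\to_f(P_1';P_2,\eta',a',w')$; $(\bot;P_2,\eta,a,w)\to_f(P_2,\eta,a,w)$; $(P_1\oplus_pP_2,\eta,a,w)\to_f(P_2,\eta,a,wR_p)$ if $[\![p]\!]_\eta\le0$, $\to_f(P_1,\eta,a,wL_p)$ if $[\![p]\!]_\eta\ge1$, and if $0<[\![p]\!]_\eta<1$ both $\to_f(P_1,\eta,a[\![p]\!]_\eta,wL_p)$ and $\to_f(P_2,\eta,a(1-[\![p]\!]_\eta),wR_p)$;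 $(P_1[\!]P_2,\eta,a,w)\to_f(P_1,\eta,a,wL_n)$ if $f(w)=L_n$, $\to_f(P_2,\eta,a,wR_n)$ if $f(w)=R_n$; $(\mathtt{while}(b)\{P\},\eta,a,w)\to_f(P;\mathtt{while}(b)\{P\},\eta,a,w)$ if $b$ holds, else $\to_f(\bot,\eta,a,w)$. $\to_f^*$ is the transitive closure. The initial execution state of $P$ is $(P,\eta_0,1,\varepsilon)$, $\eta_0\equiv0$. $\mathrm{Prob}((P,\eta,a,w))=a$. $\Pr_{\mathrm{term}}(P,f)=\sum\mathrm{Prob}(\tau)$ over all terminal execution states $\tau$ with $(P,\eta_0,1,\varepsilon)\to_f^*\tau$. $\mathsf{AST}$ is the set of programs $P$ with $\Pr_{\mathrm{term}}(P,f)=1$ for every scheduler $f$. Programs are identified with natural numbers via a fixed effective encoding; $\Pi^0_2$ is the second universal level of the arithmetical hierarchy. *)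

(* Defs.v *)
From HB Require Import structures.
From mathcomp Require Import all_boot all_order all_algebra.
From mathcomp Require Import boolp classical_sets reals ereal esum Rstruct.
Set Implicit Arguments.
Unset Strict Implicit.
Unset Printing Implicit Defensive.
Import Order.TTheory GRing.Theory Num.Theory.

Definition var := nat.

Inductive aexp : Type :=
| AConst of rat
| AVar of var
| AAdd of aexp & aexp
| ASub of aexp & aexp
| AMul of aexp & aexp
| ADiv of aexp & aexp.          (* x / 0 = 0 (MathComp convention) *)

Inductive bexp : Type :=
| BTrue
| BFalse
| BEq of aexp & aexp
| BLe of aexp & aexp
| BLt of aexp & aexp
| BNot of bexp
| BAnd of bexp & bexp
| BOr of bexp & bexp.

Inductive prog : Type :=
| Bot                                   (* the empty program ⊥ *)
| Assign of var & aexp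
| Seq of prog & prog
| PChoice of prog & aexp & prog
| NChoice of prog & prog
| While of bexp & prog.

Definition valuation := var -> rat.
Definition eta0 : valuation := fun _ => 0%R.
Definition upd (eta : valuation) (v : var) (q : rat) : valuation :=
  fun x => if x == v then q else eta x.

Fixpoint aeval (eta : valuation) (e : aexp) : rat :=
  match e with
  | AConst q => q
  | AVar v => eta v
  | AAdd a b => (aeval eta a + aeval eta b)%R
  | ASub a b => (aeval eta a - aeval eta b)%R
  | AMul a b => (aeval eta a * aeval eta b)%R
  | ADiv a b => (aeval eta a / aeval eta b)%R
  end.

Fixpoint beval (eta : valuation) (b : bexp) : bool :=
  match b with
  | BTrue => true
  | BFalse => false
  | BEq a c => aeval eta a == aeval eta c
  | BLe a c => (aeval eta a <= aeval eta c)%R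
  | BLt a c => (aeval eta a < aeval eta c)%R
  | BNot c => ~~ beval eta c
  | BAnd c d => beval eta c && beval eta d
  | BOr c d => beval eta c || beval eta d
  end.

Inductive letter : Type := Ln | Rn | Lp | Rp.

Inductive ndchoice : Type := NL | NR.

Definition scheduler := seq letter -> ndchoice.

Record state : Type := State {
  st_prog : prog;
  st_val  : valuation;
  st_prob : rat;
  st_hist : seq letter }.

HB.instance Definition _ := gen_eqMixin state.
HB.instance Definition _ := gen_choiceMixin state.

Definition terminal (s : state) : Prop := st_prog s = Bot.

Inductive step (f : scheduler) : state -> state -> Prop :=
| step_assign v e eta a w :
    step f (State (Assign v e) eta a w) (State Bot (upd eta v (aeval eta e)) a w)
| step_seq P1 P1' P2 eta eta' a a' w w' :
    step f (State P1 eta a w) (State P1' eta' a' w') ->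
    step f (State (Seq P1 P2) eta a w) (State (Seq P1' P2) eta' a' w')
| step_seq_bot P2 eta a w :
    step f (State (Seq Bot P2) eta a w) (State P2 eta a w)
| step_prob_le0 P1 P2 p eta a w :
    (aeval eta p <= 0)%R ->
    step f (State (PChoice P1 p P2) eta a w) (State P2 eta a (rcons w Rp))
| step_prob_ge1 P1 P2 p eta a w :
    (1 <= aeval eta p)%R ->
    step f (State (PChoice P1 p P2) eta a w) (State P1 eta a (rcons w Lp))
| step_prob_L P1 P2 p eta a w :
    (0 < aeval eta p < 1)%R ->
    step f (State (PChoice P1 p P2) eta a w)
           (State P1 eta (a * aeval eta p)%R (rcons w Lp))
| step_prob_R P1 P2 p eta a w :
    (0 < aeval eta p < 1)%R ->
    step f (State (PChoice P1 p P2) eta a w)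
           (State P2 eta (a * (1 - aeval eta p))%R (rcons w Rp))
| step_nd_L P1 P2 eta a w :
    f w = NL ->
    step f (State (NChoice P1 P2) eta a w) (State P1 eta a (rcons w Ln))
| step_nd_R P1 P2 eta a w :
    f w = NR ->
    step f (State (NChoice P1 P2) eta a w) (State P2 eta a (rcons w Rn))
| step_while_true b P eta a w :
    beval eta b ->
    step f (State (While b P) eta a w) (State (Seq P (While b P)) eta a w)
| step_while_false b P eta a w :
    ~~ beval eta b ->
    step f (State (While b P) eta a w) (State Bot eta a w).

Inductive steps (f : scheduler) : state -> state -> Prop :=
| steps_refl s : steps f s s
| steps_trans s t u : step f s t -> steps f t u -> steps f s u.

Definition init (P : prog) : state := State P eta0 1%R [::].

Definition Pr_term (P : prog) (f : scheduler) : \bar Rdefinitions.R :=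
  esum [set tau : state | steps f (init P) tau /\ terminal tau]
       (fun tau => (ratr (st_prob tau) : Rdefinitions.R)%:E).

Definition AST_prog (P : prog) : Prop := forall f : scheduler, Pr_term P f = 1%E.

Definition leaf := (rat + nat)%type.

Fixpoint enc_aexp (e : aexp) : GenTree.tree leaf :=
  match e with
  | AConst q => GenTree.Leaf (inl q)
  | AVar v => GenTree.Leaf (inr v)
  | AAdd a b => GenTree.Node 0 [:: enc_aexp a; enc_aexp b]
  | ASub a b => GenTree.Node 1 [:: enc_aexp a; enc_aexp b]
  | AMul a b => GenTree.Node 2 [:: enc_aexp a; enc_aexp b]
  | ADiv a b => GenTree.Node 3 [:: enc_aexp a; enc_aexp b]
  end.

Fixpoint enc_bexp (b : bexp) : GenTree.tree leaf :=
  match b with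
  | BTrue => GenTree.Node 0 [::]
  | BFalse => GenTree.Node 1 [::]
  | BEq a c => GenTree.Node 2 [:: enc_aexp a; enc_aexp c]
  | BLe a c => GenTree.Node 3 [:: enc_aexp a; enc_aexp c]
  | BLt a c => GenTree.Node 4 [:: enc_aexp a; enc_aexp c]
  | BNot c => GenTree.Node 5 [:: enc_bexp c]
  | BAnd c d => GenTree.Node 6 [:: enc_bexp c; enc_bexp d]
  | BOr c d => GenTree.Node 7 [:: enc_bexp c; enc_bexp d]
  end.

Fixpoint enc_prog (P : prog) : GenTree.tree leaf :=
  match P with
  | Bot => GenTree.Node 0 [::]
  | Assign v e => GenTree.Node 1 [:: GenTree.Leaf (inr v); enc_aexp e]
  | Seq P1 P2 => GenTree.Node 2 [:: enc_prog P1; enc_prog P2]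
  | PChoice P1 p P2 => GenTree.Node 3 [:: enc_prog P1; enc_aexp p; enc_prog P2]
  | NChoice P1 P2 => GenTree.Node 4 [:: enc_prog P1; enc_prog P2]
  | While b P1 => GenTree.Node 5 [:: enc_bexp b; enc_prog P1]
  end.

(* The code of a program: MathComp's (computable, injective) pickle of the tree. *)
Definition code (P : prog) : nat := pickle (enc_prog P).

Definition AST (n : nat) : Prop := exists P : prog, code P = n /\ AST_prog P.

Inductive aterm : Type :=
| TVar of nat
| TZero
| TSucc of aterm
| TAdd of aterm & aterm
| TMul of aterm & aterm.

(* Bounded formulas; quantifier bound terms are evaluated in the outer
   environment, the quantified variable is de Bruijn index 0 in the body. *)
Inductive d0form : Type :=
| FEq of aterm & aterm
| FLe of aterm & aterm
| FNot of d0form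
| FAnd of d0form & d0form
| FOr of d0form & d0form
| FAllLe of aterm & d0form
| FExLe of aterm & d0form.

Definition scons (x : nat) (env : nat -> nat) : nat -> nat :=
  fun i => if i is i'.+1 then env i' else x.

Fixpoint teval (env : nat -> nat) (t : aterm) : nat :=
  match t with
  | TVar i => env i
  | TZero => 0
  | TSucc u => (teval env u).+1
  | TAdd u v => teval env u + teval env v
  | TMul u v => teval env u * teval env v
  end.

Fixpoint feval (env : nat -> nat) (phi : d0form) : bool :=
  match phi with
  | FEq u v => teval env u == teval env v
  | FLe u v => teval env u <= teval env v
  | FNot psi => ~~ feval env psi
  | FAnd psi chi => feval env psi && feval env chi
  | FOr psi chi => feval env psi || feval env chi
  | FAllLe t psi => all (fun x => feval (scons x env) psi) (iota 0 (teval env t).+1)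
  | FExLe t psi => has (fun x => feval (scons x env) psi) (iota 0 (teval env t).+1)
  end.

Definition Pi02 (A : nat -> Prop) : Prop :=
  exists phi : d0form, forall n : nat,
    A n <-> (forall x : nat, exists y : nat,
               feval (scons y (scons x (scons n (fun _ => 0)))) phi).

(* Main.v *)
From mathcomp Require Import all_boot all_order all_algebra.
From mathcomp Require Import boolp classical_sets functions cardinality fsbigop.
From mathcomp Require Import reals ereal esum Rstruct.
From mathcomp Require Import ring lra zify.
Require Import Defs.
Set Implicit Arguments.
Unset Strict Implicit.
Unset Printing Implicit Defensive.
Import Order.TTheory GRing.Theory Num.Theory.

(* A lower bound on the termination probability that holds against every
   scheduler has finite derivations: a nondeterministic choice requires the same
   bound for both branches, a probabilistic one averages the bounds.  The
   supremum [value] of the derivable bounds is attained by the scheduler that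
   always moves to the branch of smaller value, because along this scheduler
   (probability so far) * value is superharmonic.  Hence a program is in AST iff
   for every k the bound 1 - 1/(k+1) is derivable.  Derivability from the code of
   a program is a least fixed point of finitary arithmetical rules, and such
   fixed points are Sigma_1: a derivation is a finite sequence, which is coded
   by Goedel's beta function. *)

(** * Arithmetical formulas *)

(** The definition of AST quantifies over schedulers, which are infinite objects, so it is not
    arithmetical as it stands. A derivation follows both branches of every nondeterministic choice
    at once and thereby absorbs this quantifier. Conversely, a single sufficiently bad scheduler has
    to be exhibited, and here the obstacle is that a scheduler sees only the history, neither the
    program nor the valuation: the minimizing choice must be recoverable from the letters recorded
    so far. Moreover [value] is a supremum that no derivation needs to attain; hence the
    approximation by 1 - 1/(k+1), whose index k becomes the universal quantifier, while the
    derivation becomes the existential one. On the arithmetical side, terms are polynomials, whereas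
    [pickle] codes lists with powers of two. Exponentiation, the parsing of codes and the evaluation
    of expressions are therefore themselves obtained as fixed points, before derivability is. *)

Notation env := (nat -> nat).

(** Functions and predicates on environments are handled semantically, the syntax being an
    existential witness. Formulas are then built by closure lemmas, and de Bruijn indices occur only
    as positions in an environment. *)
Definition poly_fun (f : env -> nat) := exists t, forall e, teval e t = f e.

Lemma poly_var i : poly_fun (fun e => e i).
Proof. by exists (TVar i). Qed.

Lemma poly_const n : poly_fun (fun _ => n).
Proof. by exists (iter n TSucc TZero) => e; elim: n => //= n ->. Qed.

Lemma poly_succ f : poly_fun f -> poly_fun (fun e => (f e).+1).
Proof. by case=> t tE; exists (TSucc t) => e; rewrite /= tE. Qed.

Lemma poly_add f g :
  poly_fun f -> poly_fun g -> poly_fun (fun e => f e + g e).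
Proof. by case=> t tE [u uE]; exists (TAdd t u) => e; rewrite /= tE uE. Qed.

Lemma poly_mul f g :
  poly_fun f -> poly_fun g -> poly_fun (fun e => f e * g e).
Proof. by case=> t tE [u uE]; exists (TMul t u) => e; rewrite /= tE uE. Qed.

Definition up (r : env) : env := fun i => if i is i'.+1 then (r i').+1 else 0.

Fixpoint tren (r : env) (t : aterm) : aterm :=
  match t with
  | TVar i => TVar (r i)
  | TZero => TZero
  | TSucc u => TSucc (tren r u)
  | TAdd u v => TAdd (tren r u) (tren r v)
  | TMul u v => TMul (tren r u) (tren r v)
  end.

Fixpoint fren (r : env) (phi : d0form) : d0form :=
  match phi with
  | FEq u v => FEq (tren r u) (tren r v)
  | FLe u v => FLe (tren r u) (tren r v)
  | FNot psi => FNot (fren r psi)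
  | FAnd psi chi => FAnd (fren r psi) (fren r chi)
  | FOr psi chi => FOr (fren r psi) (fren r chi)
  | FAllLe t psi => FAllLe (tren r t) (fren (up r) psi)
  | FExLe t psi => FExLe (tren r t) (fren (up r) psi)
  end.

Lemma teval_ren r e t : teval e (tren r t) = teval (e \o r) t.
Proof. by elim: t => //= [u -> | u -> v -> | u -> v ->]. Qed.

Lemma scons_up x e r : scons x e \o up r = scons x (e \o r).
Proof. by apply/funext; case. Qed.

Lemma feval_all e t p : feval e (FAllLe t p) <->
  forall x, x <= teval e t -> feval (scons x e) p.
Proof.
have -> : feval e (FAllLe t p) =
  all (fun x => feval (scons x e) p) (iota 0 (teval e t).+1) by [].
split=> [/(@allP nat) H x xt|H].
  by apply: H; rewrite mem_iota.
by apply/(@allP nat) => x; rewrite mem_iota; apply: H.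
Qed.

Lemma feval_ex e t p : feval e (FExLe t p) <->
  exists2 x, x <= teval e t & feval (scons x e) p.
Proof.
have -> : feval e (FExLe t p) =
  has (fun x => feval (scons x e) p) (iota 0 (teval e t).+1) by [].
split=> [/(@hasP nat)[x]|[x xt H]].
  by rewrite mem_iota; exists x.
by apply/(@hasP nat); exists x; rewrite ?mem_iota.
Qed.

Lemma feval_ren r e phi : feval e (fren r phi) = feval (e \o r) phi.
Proof.
elim: phi r e => [u v|u v|p IH|p IHp q IHq|p IHp q IHq|t p IH|t p IH] r e.
- by rewrite /= !teval_ren.
- by rewrite /= !teval_ren.
- by rewrite /= IH.
- by rewrite /= IHp IHq.
- by rewrite /= IHp IHq.
- by apply/idP/idP => /feval_all H; apply/feval_all => x;
    have := H x; rewrite teval_ren IH scons_up.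
- by apply/idP/idP => /feval_ex [x]; rewrite ?teval_ren ?IH ?scons_up => xt H;
    apply/feval_ex; exists x; rewrite ?teval_ren ?IH ?scons_up.
Qed.

Lemma poly_ren r f : poly_fun f -> poly_fun (fun e => f (fun i => e (r i))).
Proof. by case=> t tE; exists (tren r t) => e; rewrite teval_ren tE. Qed.

Definition Delta0 (R : env -> Prop) :=
  exists phi, forall e, R e <-> feval e phi.

Lemma delta0_eq f g :
  poly_fun f -> poly_fun g -> Delta0 (fun e => f e = g e).
Proof.
case=> t tE [u uE]; exists (FEq t u) => e /=; rewrite tE uE.
by split=> /eqP.
Qed.

Lemma delta0_le f g : poly_fun f -> poly_fun g -> Delta0 (fun e => f e <= g e).
Proof. by case=> t tE [u uE]; exists (FLe t u) => e /=; rewrite tE uE. Qed.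

Lemma delta0_and P Q : Delta0 P -> Delta0 Q -> Delta0 (fun e => P e /\ Q e).
Proof.
case=> t tE [u uE]; exists (FAnd t u) => e /=; rewrite tE uE.
by split=> /andP.
Qed.

Lemma delta0_or P Q : Delta0 P -> Delta0 Q -> Delta0 (fun e => P e \/ Q e).
Proof.
case=> t tE [u uE]; exists (FOr t u) => e /=; rewrite tE uE.
by split=> /orP.
Qed.

Lemma delta0_ex f (P : nat -> env -> Prop) :
  poly_fun f -> Delta0 (fun e => P (e 0) (fun i => e i.+1)) ->
  Delta0 (fun e => exists2 x, x <= f e & P x e).
Proof.
case=> t tE [u uE]; exists (FExLe t u) => e; rewrite feval_ex tE.
by split=> -[x xf /(uE (scons x e)) Px]; exists x.
Qed.

Lemma delta0_all f (P : nat -> env -> Prop) :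
  poly_fun f -> Delta0 (fun e => P (e 0) (fun i => e i.+1)) ->
  Delta0 (fun e => forall x, x <= f e -> P x e).
Proof.
case=> t tE [u uE]; exists (FAllLe t u) => e; rewrite feval_all tE.
by split=> H x /H /(uE (scons x e)).
Qed.

Lemma delta0_ren r R : Delta0 R -> Delta0 (fun e => R (fun i => e (r i))).
Proof. by case=> phi E; exists (fren r phi) => e; rewrite feval_ren; apply: E. Qed.

Definition Sigma1 (R : env -> Prop) := exists2 Q : nat -> env -> Prop,
  Delta0 (fun e => Q (e 0) (fun i => e i.+1)) &
  forall e, R e <-> exists y, Q y e.

Lemma sigma1_iff P Q : (forall e, P e <-> Q e) -> Sigma1 Q -> Sigma1 P.
Proof. by move=> PQ [F dF FE]; exists F => // e; rewrite PQ. Qed.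

Lemma sigma1_delta0 R : Delta0 R -> Sigma1 R.
Proof.
move=> dR; exists (fun _ e => R e); last by move=> e; split=> [|[]//]; exists 0.
exact: (delta0_ren S).
Qed.

Lemma sigma1_eq f g :
  poly_fun f -> poly_fun g -> Sigma1 (fun e => f e = g e).
Proof. by move=> ? ?; apply/sigma1_delta0/delta0_eq. Qed.

Lemma sigma1_le f g : poly_fun f -> poly_fun g -> Sigma1 (fun e => f e <= g e).
Proof. by move=> ? ?; apply/sigma1_delta0/delta0_le. Qed.

Lemma sigma1_ren r R : Sigma1 R -> Sigma1 (fun e => R (fun i => e (r i))).
Proof.
case=> Q dQ QE; exists (fun y e => Q y (fun i => e (r i))) => //.
exact: (delta0_ren (up r) dQ).
Qed.

(** [Sigma1] allows a single unbounded quantifier, so this one is made to bound both witnesses;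
    their maximum will do. *)
Lemma sigma1_and P Q : Sigma1 P -> Sigma1 Q -> Sigma1 (fun e => P e /\ Q e).
Proof.
case=> F dF FE [G dG GE].
exists (fun y e => exists2 y1, y1 <= y & exists2 y2, y2 <= y & F y1 e /\ G y2 e).
  apply: delta0_ex; first exact: poly_var.
  apply: delta0_ex; first exact: poly_var.
  apply: delta0_and.
    (* Below the two bounded quantifiers, index 0 is [y2], 1 is [y1], 2 is the bound [y], and the
       ambient environment starts at 3. *)
    exact: (delta0_ren (fun i => if i is i'.+1 then i'.+3 else 1) dF).
  exact: (delta0_ren (fun i => if i is i'.+1 then i'.+3 else 0) dG).
move=> e; rewrite FE GE; split.
  case=> -[y1 H1] [y2 H2]; exists (maxn y1 y2).
  by exists y1; rewrite ?leq_maxl //; exists y2; rewrite ?leq_maxr.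
by case=> y [y1 _] [y2 _] [H1 H2]; split; [exists y1|exists y2].
Qed.

Lemma sigma1_or P Q : Sigma1 P -> Sigma1 Q -> Sigma1 (fun e => P e \/ Q e).
Proof.
case=> F dF FE [G dG GE]; exists (fun y e => F y e \/ G y e).
  exact: delta0_or.
move=> e; rewrite FE GE; split.
  by case=> -[y H]; exists y; [left|right].
by case=> y [H|H]; [left|right]; exists y.
Qed.

Lemma sigma1_ex (P : nat -> env -> Prop) :
  Sigma1 (fun e => P (e 0) (fun i => e i.+1)) ->
  Sigma1 (fun e => exists x, P x e).
Proof.
case=> F dF FE.
exists (fun y e => exists2 x, x <= y & exists2 z, z <= y & F z (scons x e)).
  apply: delta0_ex; first exact: poly_var.
  apply: delta0_ex; first exact: poly_var.
  have := delta0_ren (fun i => if i is i'.+1 then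
    if i' is i''.+1 then i''.+3 else 1 else 0) dF.
  congr Delta0; apply/funext => e /=; congr F; apply/funext; by case.
move=> e; split.
  case=> x /(FE (scons x e)) [z H]; exists (maxn x z).
  by exists x; rewrite ?leq_maxl //; exists z; rewrite ?leq_maxr.
by case=> y [x _] [z _] H; exists x; apply/(FE (scons x e)); exists z.
Qed.

(* The bounded quantifier is moved inside the unbounded one by collection. *)
Lemma sigma1_all f (P : nat -> env -> Prop) :
  poly_fun f -> Sigma1 (fun e => P (e 0) (fun i => e i.+1)) ->
  Sigma1 (fun e => forall x, x <= f e -> P x e).
Proof.
move=> pf [F dF FE].
exists (fun y e => forall x, x <= f e -> exists2 z, z <= y & F z (scons x e)).
  apply: delta0_all; first exact: (poly_ren S pf).
  apply: delta0_ex; first exact: poly_var.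
  have := delta0_ren (fun i => if i is i'.+1 then
    if i' is i''.+1 then i''.+3 else 1 else 0) dF.
  congr Delta0; apply/funext => e /=; congr F; apply/funext; by case.
move=> e; split; last first.
  by case=> y H x /H [z _] Fz; apply/(FE (scons x e)); exists z.
elim: (f e) => [|n IH] H.
  have /(FE (scons 0 e))[z Fz] := H 0 isT.
  by exists z => x; rewrite leqn0 => /eqP ->; exists z.
have [|y Hy] := IH; first by move=> x xn; apply: H; rewrite ltnW.
have /(FE (scons n.+1 e))[z Fz] := H _ (leqnn n.+1).
exists (maxn y z) => x; rewrite leq_eqVlt => /orP[/eqP ->|].
  by exists z; rewrite ?leq_maxr.
rewrite ltnS => /Hy[u uy Fu]; exists u => //.
by rewrite (leq_trans uy) ?leq_maxl.
Qed.

(** A term is plugged in through a fresh quantified variable equal to it, so that renaming suffices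
    and formulas need no substitution. *)
Lemma sigma1_app (L : nat -> Prop) f :
  Sigma1 (fun e => L (e 0)) -> poly_fun f -> Sigma1 (fun e => L (f e)).
Proof.
move=> sL pf.
apply: (@sigma1_iff _ (fun e => exists x, x = f e /\ L x)).
  by move=> e; split=> [?|[x [-> //]]]; exists (f e).
apply: sigma1_ex; apply: sigma1_and; last exact: (sigma1_ren (fun _ => 0) sL).
by apply: sigma1_eq; [exact: poly_var|exact: poly_ren].
Qed.

(* A pairing that is a term of the language; it is injective because
   (a + b)^2 <= pr a b < (a + b + 1)^2. *)
Definition pr a b := (a + b) * (a + b) + a.
Arguments pr : simpl never.

Lemma pr_inj a b c d : pr a b = pr c d -> a = c /\ b = d.
Proof.
rewrite /pr => E; have : a + b = c + d by nia.
by move=> E'; rewrite E' in E; lia.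
Qed.

Lemma poly_pr f g : poly_fun f -> poly_fun g -> poly_fun (fun e => pr (f e) (g e)).
Proof. by move=> pf pg; do 2?apply: poly_add => //; apply: poly_mul; apply: poly_add. Qed.

Create HintDb sigma discriminated.

Ltac poly := cbv beta; first
  [ apply: poly_const | apply: poly_var | apply: poly_succ; poly
  | apply: poly_pr; poly | apply: poly_add; poly | apply: poly_mul; poly ].

(** Syntax-directed use of the closure properties. Fixed points enter through the hint base; a goal
    of any other shape, such as a bounded universal quantifier, is left to the caller. *)
Ltac sigma := cbv beta; first
  [ apply: sigma1_ex; sigma
  | apply: sigma1_and; sigma
  | apply: sigma1_or; sigma
  | apply: sigma1_eq; poly
  | apply: sigma1_le; poly
  | solve [auto 1 with sigma nocore]
  | apply: sigma1_app; [solve [auto 1 with sigma nocore] | poly]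
  | idtac ].

(** * Goedel's beta function *)

Definition beta_mod d i := (i.+1 * d).+1.

(** A common prime factor p divides (j - i)d. It cannot divide d, since it divides 1 + (i+1)d; so it
    divides j - i, which is at most n and hence divides d, a contradiction. *)
Lemma coprime_beta_mod n d i j :
  (forall k, 0 < k <= n -> k %| d) -> i < j <= n ->
  coprime (beta_mod d i) (beta_mod d j).
Proof.
move=> dvd /andP[ij jn]; rewrite /coprime.
set g := gcdn _ _; have : g = 1 \/ exists2 p, prime p & p %| g.
  have : 0 < g by rewrite gcdn_gt0.
  move=> g0; have [g1|g1] := leqP g 1; first by left; apply/eqP; rewrite eqn_leq g1.
  by right; exists (pdiv g); rewrite ?pdiv_prime ?pdiv_dvd.
case=> [-> //|[p pp]]; rewrite dvdn_gcd => /andP[pi pj].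
have : p %| (j - i) * d.
  have -> : (j - i) * d = beta_mod d j - beta_mod d i by rewrite /beta_mod; nia.
  exact: dvdn_sub.
have Npd : ~ p %| d.
  move=> pd; have : p %| 1; last by rewrite dvdn1 => /eqP p1; rewrite p1 in pp.
  by rewrite -(@dvdn_addr (i.+1 * d)) ?addn1 // dvdn_mull.
rewrite Euclid_dvdM // => /orP[pij|/Npd //]; case: Npd.
by apply: dvdn_trans pij _; apply: dvd; lia.
Qed.

(** The Chinese remainder theorem, applied to one more modulus at a time along the prefixes of
    [s]. *)
Lemma beta_exists (s : seq nat) : exists c d,
  forall i, i < size s -> c %% beta_mod d i = nth 0 s i.
Proof.
(* [N] bounds the indices, which makes the moduli built from its factorial pairwise coprime, and it
   bounds the entries, which are thus smaller than every modulus and equal to their residues. *)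
pose N := (size s + foldr maxn 0 s)%N.
have dvd k : 0 < k <= N -> k %| N`! by exact: dvdn_fact.
have bd i : i < size s -> nth 0 s i < beta_mod N`! i.
  move=> si; have : nth 0 s i <= N.
    rewrite /N; apply: leq_trans (leq_addl _ _).
    elim: s i si {N dvd} => //= x s IH [|i] si; first exact: leq_maxl.
    exact: leq_trans (IH _ si) (leq_maxr _ _).
  have : N <= N`! by exact: fact_geq.
  rewrite /beta_mod; nia.
suff [c Hc] : exists c, forall i, i < size s -> c = nth 0 s i %[mod beta_mod N`! i].
  by exists c, N`! => i si; rewrite Hc // modn_small ?bd.
have : size s <= size s by [].
elim: {-2}(size s) => [|k IH] ks; first by exists 0.
have [|c Hc] := IH; first exact: ltnW.
pose M := \prod_(i < k) beta_mod N`! i.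
have cop : coprime M (beta_mod N`! k).
  rewrite /M; elim/big_ind: _ => [|a b ca cb|i _]; first exact: coprime1n.
    by rewrite coprimeMl ca.
  by apply: (coprime_beta_mod dvd); rewrite ltn_ord /= /N; lia.
exists (chinese M (beta_mod N`! k) c (nth 0 s k)) => i.
rewrite ltnS leq_eqVlt => /orP[/eqP ->|ik]; first exact: chinese_modr.
rewrite -Hc //; have /(congr1 (modn^~ (beta_mod N`! i))) := chinese_modl cop c (nth 0 s k).
by rewrite !modn_dvdm // /M (bigD1 (Ordinal ik)) //= dvdn_mulr.
Qed.

(** * Least fixed points of finitary rules *)

(* A rule with a single premise is encoded by repeating the premise. *)
Inductive lfp (A : nat -> Prop) (D : nat -> nat -> nat -> Prop) : nat -> Prop :=
| lfp_ax x : A x -> lfp A D x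
| lfp_rule x a b : D x a b -> lfp A D a -> lfp A D b -> lfp A D x.

Definition derivation A D (s : seq nat) := forall i, i < size s ->
  A (nth 0 s i) \/
  exists j k, [/\ j < i, k < i & D (nth 0 s i) (nth 0 s j) (nth 0 s k)].

Lemma derivation_cat A D s t :
  derivation A D s -> derivation A D t -> derivation A D (s ++ t).
Proof.
move=> ds dt i; rewrite size_cat nth_cat => it; case: ltnP => si.
  have [?|[j [k [ji ki H]]]] := ds i si; [by left|right; exists j, k].
  by rewrite !nth_cat (ltn_trans ji si) (ltn_trans ki si).
have [||[j [k [ji ki H]]]] := dt (i - size s); [by lia|by left|right].
exists (j + size s), (k + size s); rewrite !nth_cat.
have -> : (j + size s < size s) = false by lia.
have -> : (k + size s < size s) = false by lia.
by rewrite !addnK; split=> //; lia.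
Qed.

Lemma derivation_rcons A D s x a b : derivation A D s ->
  a \in s -> b \in s -> D x a b -> derivation A D (rcons s x).
Proof.
move=> ds sa sb H i; rewrite size_rcons ltnS nth_rcons => si.
case: ltngtP si => // [si _|-> _].
  have [?|[j [k [ji ki H']]]] := ds i si; [by left|right; exists j, k].
  by rewrite !nth_rcons (ltn_trans ji si) (ltn_trans ki si).
right; exists (index a s), (index b s).
by rewrite !nth_rcons !index_mem sa sb !nth_index.
Qed.

(** A proof tree is linearized by concatenating the derivations of the two premises; conversely,
    strong induction on the position puts every entry into the fixed point. *)
Lemma lfp_derivation A D x :
  lfp A D x <-> exists s, derivation A D (rcons s x).
Proof.
split=> [|[s ds]].
  elim=> {x} [x Ax|x a b H _ [s ds] _ [t dt]].
    by exists [::] => -[|//] _; left.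
  exists (rcons s a ++ rcons t b); apply: derivation_rcons H.
  - exact: derivation_cat.
  - by rewrite mem_cat mem_rcons mem_head.
  - by rewrite mem_cat orbC mem_rcons mem_head.
have sx i : i < (size s).+1 -> lfp A D (nth 0 (rcons s x) i).
  elim/ltn_ind: i => i IH si; have := ds i; rewrite size_rcons => /(_ si).
  case=> [/lfp_ax//|[j [k [ji ki H]]]].
  by apply: lfp_rule H _ _; apply: IH => //; lia.
by have := sx _ (ltnSn _); rewrite nth_rcons ltnn eqxx.
Qed.

(** The quotient is quantified existentially instead of dividing, which makes the graph of the
    remainder visibly Sigma_1. *)
Definition beta_graph c d i v :=
  exists q, c = q * beta_mod d i + v /\ v < beta_mod d i.

Lemma beta_graphP c d i v : beta_graph c d i v <-> v = c %% beta_mod d i.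
Proof.
split=> [[q [-> lt]]|->]; first by rewrite modnMDl modn_small.
by exists (c %/ beta_mod d i); rewrite -divn_eq ltn_mod.
Qed.

(** [c] and [d] code the sequence, and [l] is the index of its last entry. The quantifier over [i]
    is bounded but has unbounded existentials in its scope; this is the place where collection is
    used. *)
Definition coded_derivation A D c d l x := beta_graph c d l x /\
  forall i, i <= l -> exists v, beta_graph c d i v /\
    (A v \/ exists j k a b, (j < i /\ k < i) /\
      beta_graph c d j a /\ beta_graph c d k b /\ D v a b).

Lemma lfp_coded A D x :
  lfp A D x <-> exists c d l, coded_derivation A D c d l x.
Proof.
rewrite lfp_derivation; split=> [[s ds]|[c [d [l [/beta_graphP -> H]]]]].
  have [c [d E]] := beta_exists (rcons s x); rewrite size_rcons in E.
  exists c, d, (size s); split.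
    by apply/beta_graphP; rewrite E // nth_rcons ltnn eqxx.
  move=> i si; exists (nth 0 (rcons s x) i); split; first by apply/beta_graphP; rewrite E.
  have := ds i; rewrite size_rcons => /(_ si)[?|[j [k [ji ki H]]]]; first by left.
  right; exists j, k, (nth 0 (rcons s x) j), (nth 0 (rcons s x) k).
  by do !split=> //; apply/beta_graphP; rewrite E //; lia.
exists (mkseq (fun i => c %% beta_mod d i) l).
have -> : rcons (mkseq (fun i => c %% beta_mod d i) l) (c %% beta_mod d l) =
   mkseq (fun i => c %% beta_mod d i) l.+1 by rewrite mkseqS.
move=> i; rewrite size_mkseq => il; rewrite !nth_mkseq //.
have [v [/beta_graphP -> [?|]]] := H i il; first by left.
case=> j [k [a [b [[ji ki] [/beta_graphP -> [/beta_graphP -> ?]]]]]].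
by right; exists j, k; rewrite !nth_mkseq ?(ltn_trans ji il) ?(ltn_trans ki il).
Qed.

Lemma sigma1_app3 (D : nat -> nat -> nat -> Prop) f g h :
  Sigma1 (fun e => D (e 0) (e 1) (e 2)) ->
  poly_fun f -> poly_fun g -> poly_fun h ->
  Sigma1 (fun e => D (f e) (g e) (h e)).
Proof.
move=> sD pf pg ph.
apply: (@sigma1_iff _ (fun e => exists x y z,
  x = f e /\ y = g e /\ z = h e /\ D x y z)).
  move=> e; split=> [?|[x [y [z [-> [-> [-> //]]]]]]].
  by exists (f e), (g e), (h e).
have ps f' : poly_fun f' -> poly_fun (fun e => f' (fun i => e i.+3)).
  exact: (poly_ren (fun i => i.+3)).
do 3!apply: sigma1_ex; do !apply: sigma1_and; last first.
(* The innermost variable is [z], so the three arguments sit at indices 2, 1, 0. *)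
- exact: (sigma1_ren (fun i => match i with 0 => 2 | 1 => 1 | _ => 0 end) sD).
- by apply: sigma1_eq; [exact: poly_var|exact: ps].
- by apply: sigma1_eq; [exact: poly_var|exact: ps].
- by apply: sigma1_eq; [exact: poly_var|exact: ps].
Qed.

Theorem sigma1_lfp A D :
  Sigma1 (fun e => A (e 0)) -> Sigma1 (fun e => D (e 0) (e 1) (e 2)) ->
  Sigma1 (fun e => lfp A D (e 0)).
Proof.
move=> sA sD; apply: sigma1_iff; first by move=> e; exact: lfp_coded.
rewrite /coded_derivation /beta_graph /beta_mod.
sigma; apply: sigma1_all; first by poly.
sigma; by apply: (sigma1_app3 sD); poly.
Qed.

(** * Finitely derivable termination guarantees *)

Section TerminationGuarantees.
Local Open Scope ring_scope.

Notation R := Rdefinitions.R.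

(* The program [P] with continuation [K] stands for the program [foldl Seq P K]. *)
Inductive guarantee : prog -> seq prog -> valuation -> rat -> Prop :=
| guarantee_zero P K eta : guarantee P K eta 0
| guarantee_weak P K eta q r : q <= r -> guarantee P K eta r -> guarantee P K eta q
| guarantee_end eta : guarantee Bot [::] eta 1
| guarantee_bot P K eta q : guarantee P K eta q -> guarantee Bot (P :: K) eta q
| guarantee_assign v e K eta q :
    guarantee Bot K (upd eta v (aeval eta e)) q -> guarantee (Assign v e) K eta q
| guarantee_seq P Q K eta q : guarantee P (Q :: K) eta q -> guarantee (Seq P Q) K eta q
| guarantee_prob_le0 P p Q K eta q :
    aeval eta p <= 0 -> guarantee Q K eta q -> guarantee (PChoice P p Q) K eta q
| guarantee_prob_ge1 P p Q K eta q :
    1 <= aeval eta p -> guarantee P K eta q -> guarantee (PChoice P p Q) K eta q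
| guarantee_prob P p Q K eta q1 q2 : 0 < aeval eta p < 1 ->
    guarantee P K eta q1 -> guarantee Q K eta q2 ->
    guarantee (PChoice P p Q) K eta (aeval eta p * q1 + (1 - aeval eta p) * q2)
| guarantee_nd P Q K eta q :
    guarantee P K eta q -> guarantee Q K eta q -> guarantee (NChoice P Q) K eta q
| guarantee_while_true b P K eta q : beval eta b ->
    guarantee P (While b P :: K) eta q -> guarantee (While b P) K eta q
| guarantee_while_false b P K eta q : ~~ beval eta b ->
    guarantee Bot K eta q -> guarantee (While b P) K eta q.

Lemma guarantee_le1 P K eta q : guarantee P K eta q -> q <= 1.
Proof.
elim=> // {P K eta q} [P K eta q r qr _ r1|P p Q K eta q1 q2 /andP[p0 p1] _ h1 _ h2].
  exact: le_trans r1.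
by nra.
Qed.

(** Besides [guarantee_seq] only the zero and the weakening rule can conclude with a [Seq], and both
    can be replayed for [P] with the longer continuation. *)
Lemma guarantee_seq_inv P Q K eta q : guarantee (Seq P Q) K eta q -> guarantee P (Q :: K) eta q.
Proof.
move E: (Seq P Q) => S H; elim: H E => //.
- by move=> *; exact: guarantee_zero.
- by move=> {}S {}K {}eta {}q r qr _ IH E; apply: guarantee_weak qr (IH E).
- by move=> P' Q' {}K {}eta {}q H _ [-> ->].
Qed.

Lemma guarantee_foldl P K K' eta q :
  guarantee (foldl Seq P K) K' eta q <-> guarantee P (K ++ K') eta q.
Proof.
elim: K P => //= Q K IH P; rewrite IH; split; first exact: guarantee_seq_inv.
exact: guarantee_seq.
Qed.

(** * Head and continuation of a program, and inversion of its steps *)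

Definition is_seq P := if P is Seq _ _ then true else false.

Lemma foldl_seq_exists S : exists P K, S = foldl Seq P K /\ ~~ is_seq P.
Proof.
elim: S => [|v e|A [P [K [-> HP]]] B _|A _ p B _|A _ B _|b A _].
- by exists Bot, [::].
- by exists (Assign v e), [::].
- by exists P, (rcons K B); rewrite foldl_rcons.
- by exists (PChoice A p B), [::].
- by exists (NChoice A B), [::].
- by exists (While b A), [::].
Qed.

Lemma foldl_seq_Bot P K : foldl Seq P K = Bot -> P = Bot /\ K = [::].
Proof. by elim/last_ind: K => //= K Q _; rewrite foldl_rcons. Qed.

Lemma step_Bot f eta a w t : ~ step f (State Bot eta a w) t.
Proof. by move=> H; inversion H. Qed.

Lemma step_Seq_inv f P Q eta a w t : step f (State (Seq P Q) eta a w) t ->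
  (exists P' eta' a' w', step f (State P eta a w) (State P' eta' a' w') /\
     t = State (Seq P' Q) eta' a' w') \/
  P = Bot /\ t = State Q eta a w.
Proof. by move=> H; inversion H; subst; [left; do 4!eexists; split; eauto|right]. Qed.

Lemma step_PChoice_inv f P p Q eta a w t : 0 < aeval eta p < 1 ->
  step f (State (PChoice P p Q) eta a w) t ->
  t = State P eta (a * aeval eta p) (rcons w Lp) \/
  t = State Q eta (a * (1 - aeval eta p)) (rcons w Rp).
Proof.
move=> p01 H; inversion H; subst; [exfalso; lra|exfalso; lra|by left|by right].
Qed.

Lemma step_foldl f P K eta a w P' eta' a' w' :
  step f (State P eta a w) (State P' eta' a' w') ->
  step f (State (foldl Seq P K) eta a w) (State (foldl Seq P' K) eta' a' w').
Proof. by elim: K P P' => //= Q K IH P P' H; apply/IH/step_seq. Qed.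

Lemma step_foldl_inv f P K eta a w t : ~~ is_seq P ->
  step f (State (foldl Seq P K) eta a w) t ->
  (P = Bot /\ exists Q K', K = Q :: K' /\ t = State (foldl Seq Q K') eta a w) \/
  (exists P' eta' a' w', step f (State P eta a w) (State P' eta' a' w') /\
     t = State (foldl Seq P' K) eta' a' w').
Proof.
move=> HP; elim/last_ind: K t => [|K Q IH] [P1 eta1 a1 w1].
  by move=> H; right; exists P1, eta1, a1, w1.
rewrite foldl_rcons => /step_Seq_inv[[P' [eta' [a' [w' [/IH H ->]]]]]|[E ->]].
  case: H => [[-> [Q' [K' [-> [-> -> -> ->]]]]]|].
    by left; split=> //; exists Q', (rcons K' Q); rewrite foldl_rcons.
  move=> [P2 [eta2 [a2 [w2 [H2 [-> -> -> ->]]]]]]; right.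
  by exists P2, eta2, a2, w2; rewrite foldl_rcons.
case: (foldl_seq_Bot E) => -> ->; left; split=> //.
by exists Q, [::].
Qed.

(** * Histories determine runs *)

Lemma step_hist f s t : step f s t ->
  st_hist t = st_hist s \/ exists x, st_hist t = rcons (st_hist s) x.
Proof.
elim=> //=; try by [left]; try by intros; right; eexists.
Qed.

Lemma steps_hist f s t : steps f s t -> exists u, st_hist t = st_hist s ++ u.
Proof.
elim=> {s t} [s|s t u /step_hist H _ [v ->]]; first by exists [::]; rewrite cats0.
case: H => [->|[x ->]]; first by exists v.
by exists (x :: v); rewrite cat_rcons.
Qed.

(** Successors can differ only at a choice, be it of the schedulers or of chance, and every choice
    appends its own letter; so two runs either agree or diverge visibly in the history. *)
Lemma step_fork f g s t u : step f s t -> step g s u -> t = u \/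
  exists x y, [/\ x <> y, st_hist t = rcons (st_hist s) x &
    st_hist u = rcons (st_hist s) y].
Proof.
move=> H; elim: H u => {s t}.
- by move=> v e eta a w u H; inversion H; left.
- move=> P1 P1' P2 eta eta' a a' w w' H IH u /step_Seq_inv[].
    move=> [P3 [eta2 [a2 [w2 [/IH H2 ->]]]]].
    case: H2 => [[-> -> -> ->]|[x [y [xy /= E1 E2]]]]; first by left.
    by right; exists x, y.
  by move=> [E _]; rewrite E in H; case: (step_Bot H).
- move=> P2 eta a w u /step_Seq_inv[|[_ ->]]; last by left.
  by move=> [P' [eta' [a' [w' [/step_Bot]]]]].
- move=> P1 P2 p eta a w p0 u H; inversion H; subst; try (by left); exfalso; lra.
- move=> P1 P2 p eta a w p0 u H; inversion H; subst; try (by left); exfalso; lra.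
- move=> P1 P2 p eta a w p0 u H; inversion H; subst; try (by left); try (exfalso; lra).
  by right; exists Lp, Rp.
- move=> P1 P2 p eta a w p0 u H; inversion H; subst; try (by left); try (exfalso; lra).
  by right; exists Rp, Lp.
- move=> P1 P2 eta a w _ u H; inversion H; subst; first by left.
  by right; exists Ln, Rn.
- move=> P1 P2 eta a w _ u H; inversion H; subst; last by left.
  by right; exists Rn, Ln.
- move=> b P eta a w hb u H; inversion H; subst; first by left.
  by exfalso; move: hb; apply/negP.
- move=> b P eta a w hb u H; inversion H; subst; last by left.
  by exfalso; move: hb; apply/negP/negPn.
Qed.

Fixpoint is_nd P :=
  match P with Seq A _ => is_nd A | NChoice _ _ => true | _ => false end.

Lemma step_nd_hist f s t : is_nd (st_prog s) -> step f s t ->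
  exists x, st_hist t = rcons (st_hist s) x.
Proof.
move=> nd H; elim: H nd => //=; try by intros; eexists.
Qed.

(** Silent steps let several states of one run share a history. A nondeterministic state appends a
    letter at once and histories only grow, so it is the last state of its run carrying that
    history. *)
Lemma step_nd_nsteps f g s t u : is_nd (st_prog s) ->
  step f s t -> steps g t u -> st_hist u <> st_hist s.
Proof.
move=> nd /(step_nd_hist nd)[x Ex] /steps_hist[v ->].
by rewrite Ex => /(congr1 size); rewrite size_cat size_rcons; lia.
Qed.

(* The history records every choice, so it determines the run up to
   deterministic steps, whatever the schedulers are. *)
Lemma nd_state_unique f g s t u :
  steps f s t -> steps g s u -> is_nd (st_prog t) -> is_nd (st_prog u) ->
  st_hist t = st_hist u -> t = u.
Proof.
move=> H; elim: H u => {s t} [s|s s1 t H1 H1t IH] u H2.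
  case: H2 => // {u} s' s2 u st2 s2u nds _ E.
  by case: (step_nd_nsteps nds st2 s2u).
case: H2 IH H1 => [s' _ H1 _ nds E|s' s2 {}u H2 H2u IH H1 ndt ndu E].
  by case: (step_nd_nsteps nds H1 H1t).
case: (step_fork H1 H2) => [E12|[x [y [xy E1 E2]]]].
  by apply: IH => //; rewrite E12.
case/steps_hist: H1t E => v1 ->; case/steps_hist: H2u => v2 ->.
rewrite E1 E2 !cat_rcons => /(congr1 (drop (size (st_hist s')))).
by rewrite !drop_size_cat // => -[].
Qed.

(** * Derivable bounds are lower bounds for the termination probability *)

Local Open Scope ereal_scope.
Local Open Scope classical_set_scope.

Definition mass (tau : state) : \bar R := (ratr (st_prob tau) : R)%:E.

(** [st_prob] accumulates along a run, so these masses are absolute and not conditional on [s]: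
    different states of a run compare without rescaling. *)
Definition Pr_from f s : \bar R :=
  esum [set tau | steps f s tau /\ terminal tau] mass.

Lemma step_prob_ge0 f s t : step f s t ->
  (0 <= st_prob s -> 0 <= st_prob t)%R.
Proof.
elim=> //= P1 P2 p eta a _ /andP[p0 p1] a0; apply: mulr_ge0 => //.
  exact: ltW.
by rewrite subr_ge0 ltW.
Qed.

Lemma steps_prob_ge0 f s t : steps f s t ->
  (0 <= st_prob s -> 0 <= st_prob t)%R.
Proof. by elim=> // {}s t' u /step_prob_ge0 H _ IH /H. Qed.

Lemma mass_ge0 s : (0 <= st_prob s)%R -> 0 <= mass s.
Proof. by move=> H; rewrite lee_fin ler0q. Qed.

Lemma esum_le_subset (A B : set state) (m : state -> \bar R) :
  A `<=` B -> esum A m <= esum B m.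
Proof.
move=> AB; apply: ge_ereal_sup => _ [F [finF FA] <-].
by apply: esum_ge; exists F => //; split=> // x /FA/AB.
Qed.

Lemma esum_leU (A B : set state) (m : state -> \bar R) :
  (forall x, (A `|` B) x -> 0 <= m x) ->
  esum (A `|` B) m <= esum A m + esum B m.
Proof.
move=> m0; rewrite (esumID A) //; apply: leeD; apply: esum_le_subset.
  by move=> x [].
by move=> x [[]].
Qed.

Lemma Pr_from_step f s t : step f s t -> Pr_from f t <= Pr_from f s.
Proof.
move=> H; apply: esum_le_subset => tau [H2 T]; split=> //.
exact: steps_trans H H2.
Qed.

(** [esum] ranges over a set of states, so a terminal state common to both branches would count only
    once. The differing letters persist in all later histories and keep the branches disjoint. *)
Lemma Pr_from_fork f s t u x y : (0 <= st_prob s)%R ->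
  step f s t -> step f s u -> x <> y ->
  st_hist t = rcons (st_hist s) x -> st_hist u = rcons (st_hist s) y ->
  Pr_from f t + Pr_from f u <= Pr_from f s.
Proof.
move=> s0 st su xy Et Eu; rewrite [leRHS]/Pr_from (esumID [set tau | steps f t tau]).
  apply: leeD; apply: esum_le_subset => tau [H T] /=; do !split=> //.
  - exact: steps_trans st H.
  - exact: steps_trans su H.
  - move=> H'; case/steps_hist: H => v Ev; case/steps_hist: H' => v'.
    rewrite Ev Et Eu !cat_rcons => /(congr1 (drop (size (st_hist s)))).
    by rewrite !drop_size_cat // => -[/esym].
by move=> tau [/steps_prob_ge0 H _]; apply/mass_ge0/H.
Qed.

(** At a nondeterministic choice the scheduler takes one branch, and the rule has supplied the bound
    for both. [a] and [w] are generalized because they change along the run. *)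
Lemma guarantee_le_Pr_from f P K eta q : guarantee P K eta q -> forall a w, (0 <= a)%R ->
  (ratr (a * q) : R)%:E <= Pr_from f (State (foldl Seq P K) eta a w).
Proof.
have Pr_from_ge0 s : (0 <= st_prob s)%R -> 0 <= Pr_from f s.
  by move=> s0; apply: esum_ge0 => tau [/steps_prob_ge0 H _]; apply/mass_ge0/H.
elim=> {P K eta q}.
- by move=> P K eta a w a0; rewrite mulr0 rmorph0 Pr_from_ge0.
- move=> P K eta q r qr _ IH a w a0; apply: le_trans (IH a w a0).
  by rewrite lee_fin ler_rat ler_wpM2l.
- move=> eta a w a0; rewrite mulr1.
  apply: le_trans (_ : esum [set State Bot eta a w] mass <= _).
    by rewrite esum_set1 // mass_ge0.
  by apply: esum_le_subset => _ ->; split=> //; exact: steps_refl.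
- move=> P K eta q _ IH a w a0; apply: le_trans (IH a w a0) _; apply: Pr_from_step.
  exact/(@step_foldl f (Seq Bot P))/step_seq_bot.
- move=> v e K eta q _ IH a w a0; apply: le_trans (IH a w a0) _; apply: Pr_from_step.
  by apply/step_foldl/step_assign.
- by move=> P Q K eta q _ IH.
- move=> P p Q K eta q p0 _ IH a w a0.
  apply: le_trans (IH a (rcons w Rp) a0) _; apply: Pr_from_step.
  exact/step_foldl/step_prob_le0.
- move=> P p Q K eta q p0 _ IH a w a0.
  apply: le_trans (IH a (rcons w Lp) a0) _; apply: Pr_from_step.
  exact/step_foldl/step_prob_ge1.
- move=> P p Q K eta q1 q2 p01 _ IH1 _ IH2 a w a0.
  have /andP[p0 p1] := p01.
  apply: le_trans (_ : Pr_from f (State (foldl Seq P K) eta (a * aeval eta p)%R (rcons w Lp))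
    + Pr_from f (State (foldl Seq Q K) eta (a * (1 - aeval eta p))%R (rcons w Rp)) <= _).
    rewrite mulrDr !mulrA rmorphD EFinD; apply: leeD.
      by apply: IH1; rewrite mulr_ge0 // ltW.
    by apply: IH2; rewrite mulr_ge0 // subr_ge0 ltW.
  apply: (Pr_from_fork (x := Lp) (y := Rp)) => //.
    exact/step_foldl/step_prob_L.
  exact/step_foldl/step_prob_R.
- move=> P Q K eta q _ IH1 _ IH2 a w a0; case E: (f w).
    apply: le_trans (IH1 a (rcons w Ln) a0) _; apply: Pr_from_step.
    exact/step_foldl/step_nd_L.
  apply: le_trans (IH2 a (rcons w Rn) a0) _; apply: Pr_from_step.
  exact/step_foldl/step_nd_R.
- move=> b P K eta q hb _ IH a w a0; apply: le_trans (IH a w a0) _.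
  by apply: Pr_from_step => /=; apply/step_foldl/step_while_true.
- move=> b P K eta q hb _ IH a w a0; apply: le_trans (IH a w a0) _.
  by apply: Pr_from_step => /=; apply/step_foldl/step_while_false.
Qed.

(** * Superharmonic functions as upper bounds *)

Fixpoint reach f n s t :=
  if n is n'.+1 then s = t \/ exists u, step f s u /\ reach f n' u t else s = t.

Lemma reach_mono f n m s t : (n <= m)%N -> reach f n s t -> reach f m s t.
Proof.
elim: n m s => [|n IH] [|m] s //=; first by left.
rewrite ltnS => nm [->|[u [su H]]]; first by left.
by right; exists u; split=> //; apply: IH H.
Qed.

Lemma steps_reach f s t : steps f s t -> exists n, reach f n s t.
Proof.
elim=> [{}s|{}s u v su _ [n H]]; first by exists 0%N.
by exists n.+1; right; exists u.
Qed.

Lemma reach_steps f n s t : reach f n s t -> steps f s t.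
Proof.
elim: n s => [|n IH] s /=; first by move=> ->; exact: steps_refl.
case=> [->|[u [su /IH H]]]; first exact: steps_refl.
exact: steps_trans su H.
Qed.

(** The sum over successors carries no weights, because the branching probabilities are already
    contained in [st_prob] of the successors. The finite list has to cover the successors but need
    not enumerate them exactly. *)
Definition superharmonic f (I : state -> Prop) (G : state -> R) :=
  forall s, I s -> [/\ (0 <= st_prob s)%R,
    terminal s -> (ratr (st_prob s) <= G s)%R, (0 <= G s)%R &
    exists l : seq state, [/\ forall t, step f s t -> List.In t l,
      forall t, List.In t l -> I t & (\sum_(t <- l) G t <= G s)%R]].

(** Induction on [n] bounds the mass of the terminal states reached within [n] steps. This is
    enough, since [esum] is a supremum over finite sets and a finite set of reachable states is
    reached within a common number of steps. *)
Lemma Pr_from_le_superharmonic f I G s :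
  superharmonic f I G -> I s -> Pr_from f s <= (G s)%:E.
Proof.
move=> sup Is.
pose E n s := esum [set tau | reach f n s tau /\ terminal tau] mass.
have bound n : forall s, I s -> E n s <= (G s)%:E.
  elim: n => [|n IH] {Is}s Is; have [s0 sT G0 [l [sl lI lG]]] := sup s Is.
    apply: le_trans (_ : esum [set tau | tau = s /\ terminal s] mass <= _).
      by apply: esum_le_subset => _ [<-].
    have [T|NT] := pselect (terminal s).
      apply: le_trans (_ : esum [set s] mass <= _).
        by apply: esum_le_subset => _ [->].
      by rewrite esum_set1 ?mass_ge0 // lee_fin sT.
    by rewrite esum1 // => t [].
  have [T|NT] := pselect (terminal s).
    apply: le_trans (_ : esum [set s] mass <= _).
      apply: esum_le_subset => tau [[->//|[u [su _]]] _].
      by case: s T su {s0 sT Is G0 sl lG} => P eta a w; rewrite /terminal /= => -> /step_Bot.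
    by rewrite esum_set1 ?mass_ge0 // lee_fin sT.
  apply: le_trans (_ : esum [set tau | (exists t, List.In t l /\ reach f n t tau)
     /\ terminal tau] mass <= _).
    apply: esum_le_subset => tau [[<- //|[u [/sl su H]]] T]; split=> //.
    by exists u.
  apply: le_trans (_ : (\sum_(t <- l) G t)%:E <= _); last by rewrite lee_fin.
  (* The terminal states are split by the listed successor they are reached from; overlaps are
     harmless by subadditivity. *)
  elim: l lI {sl lG} => [|t l IHl] lI.
    by rewrite big_nil esum1 // => tau [[t []]].
  rewrite big_cons EFinD; set A := [set tau | _].
  have -> : A = [set tau | reach f n t tau /\ terminal tau] `|`
     [set tau | (exists t, List.In t l /\ reach f n t tau) /\ terminal tau].
    apply/seteqP; split=> tau.
      by move=> [[u [[<-|ul] H]] T]; [left|right; split=> //; exists u].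
    move=> [[H T]|[[u [ul H]] T]]; split=> //; first by exists t; split=> //; left.
    by exists u; split=> //; right.
  apply: le_trans; first apply: esum_leU.
    move=> tau H; apply: mass_ge0.
    have [u [lu]] : exists u, List.In u (t :: l) /\ reach f n u tau.
      case: H => [[H _]|[[u [ul H]] _]]; first by exists t; split=> //; left.
      by exists u; split=> //; right.
    have [u0 _ _ _] := sup u (lI u lu).
    by move=> /reach_steps /steps_prob_ge0; exact.
  apply: leeD; first by apply: IH; apply: lI; left.
  by apply: IHl => u lu; apply: lI; right.
apply: ge_ereal_sup => _ [F [/finite_seqP [r ->] FS] <-].
have [n Hn] : exists n, forall tau, tau \in r -> reach f n s tau.
  elim: r FS => [|t r IHr] FS; first by exists 0%N.
  case: IHr => [tau rt|n Hn]; first by apply: FS; rewrite /= inE rt orbT.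
  have [|/steps_reach[m Hm] _] := FS t; first by rewrite /= inE eqxx.
  exists (maxn n m) => tau; rewrite inE => /orP[/eqP ->|/Hn H].
    by apply: reach_mono Hm; exact: leq_maxr.
  by apply: reach_mono H; exact: leq_maxl.
apply: le_trans (bound n s Is); apply: ereal_sup_ubound; exists [set` r] => //.
split=> [|tau /= rt]; first exact: finite_seq.
by split; [apply: Hn|case: (FS tau rt)].
Qed.

Local Close Scope ereal_scope.

(** * The supremum of the derivable bounds *)

Definition value P K eta : R := sup [set (ratr q : R) | q in guarantee P K eta].

Lemma value_has_sup P K eta : has_sup [set (ratr q : R) | q in guarantee P K eta].
Proof.
split; first by exists (ratr 0), 0 => //; exact: guarantee_zero.
by exists 1 => _ [q /guarantee_le1 q1 <-]; rewrite -(rmorph1 (@ratr R)) ler_rat.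
Qed.

Lemma guarantee_le_value P K eta q : guarantee P K eta q -> ratr q <= value P K eta.
Proof.
by move=> H; apply: sup_upper_bound; [exact: value_has_sup|exists q].
Qed.

Lemma value_le P K eta (c : R) :
  (forall q, guarantee P K eta q -> ratr q <= c) -> value P K eta <= c.
Proof.
move=> H; apply: ge_sup; first by case: (value_has_sup P K eta).
by move=> _ [q Hq <-]; apply: H.
Qed.

Lemma value_ge0 P K eta : 0 <= value P K eta.
Proof. by have := guarantee_le_value (guarantee_zero P K eta); rewrite rmorph0. Qed.

Lemma value_mono P K eta P' K' eta' :
  (forall q, guarantee P K eta q -> guarantee P' K' eta' q) -> value P K eta <= value P' K' eta'.
Proof. by move=> H; apply: value_le => q /H; exact: guarantee_le_value. Qed.

Lemma value_foldl P K K' eta : value (foldl Seq P K) K' eta = value P (K ++ K') eta.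
Proof. by apply: le_anti; rewrite !value_mono // => q /guarantee_foldl. Qed.

Lemma value_prob P p Q K eta : 0 < aeval eta p < 1 ->
  ratr (aeval eta p) * value P K eta + ratr (1 - aeval eta p) * value Q K eta
    <= value (PChoice P p Q) K eta.
Proof.
move=> p01; have /andP[p0 p1] := p01.
set r : R := ratr (aeval eta p); set r' : R := ratr _.
have r0 : 0 < r by rewrite ltr0q.
have r0' : 0 < r' by rewrite ltr0q subr_gt0.
(* Each value in turn is isolated on the left, so that [value_le] replaces it by a derivable bound;
   the two suprema are thus treated independently. *)
rewrite -lerBrDl mulrC -ler_pdivlMr //; apply: value_le => q2 H2.
rewrite ler_pdivlMr // lerBrDl addrC -lerBrDl mulrC -ler_pdivlMr //.
apply: value_le => q1 H1; rewrite ler_pdivlMr // lerBrDl addrC.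
rewrite [ratr q1 * r]mulrC [ratr q2 * r']mulrC -!rmorphM -rmorphD.
by apply: guarantee_le_value; apply: guarantee_prob.
Qed.

(** Suprema need not be attained, so a bound [q1] for [P] may exceed every bound derivable for [Q].
    In that case all bounds for [Q] weaken those for [P], hence are derivable for the choice, and q1
    <= value P <= value Q passes through [Q]. *)
Lemma value_nd P Q K eta : value P K eta <= value Q K eta -> value P K eta <= value (NChoice P Q) K eta.
Proof.
move=> PQ; apply: value_le => q1 H1.
have [[q2 q12 H2]|N] := pselect (exists2 q2, q1 <= q2 & guarantee Q K eta q2).
  by apply: guarantee_le_value; apply: guarantee_nd => //; apply: guarantee_weak q12 H2.
apply: le_trans (le_trans (guarantee_le_value H1) PQ) _; apply: value_mono => q2 H2.
apply: guarantee_nd => //; apply: guarantee_weak H1; have [//|q12] := leP q2 q1.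
by case: N; exists q2 => //; exact: ltW.
Qed.

Lemma value_nd_sym P Q K eta : value (NChoice P Q) K eta = value (NChoice Q P) K eta.
Proof.
suff H A B q : guarantee (NChoice A B) K eta q -> guarantee (NChoice B A) K eta q.
  by apply: le_anti; rewrite !value_mono // => q; exact: H.
move E: (NChoice A B) => S T; elim: T E => //.
- by move=> *; exact: guarantee_zero.
- by move=> S' K' eta' q' r qr _ IH E; apply: guarantee_weak qr (IH E).
- by move=> ? ? ? ? ? ? _ ? _ [-> ->]; apply: guarantee_nd.
Qed.

(** * A scheduler that minimizes the value *)

Fixpoint resolve (c : ndchoice) P :=
  match P with
  | Seq A B => Seq (resolve c A) B
  | NChoice A B => if c is NL then A else B
  | _ => P
  end.

Lemma resolve_foldl c P Q K : resolve c (foldl Seq (NChoice P Q) K) =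
  foldl Seq (if c is NL then P else Q) K.
Proof. by elim/last_ind: K => //= K S IH; rewrite !foldl_rcons /= IH. Qed.

Lemma is_nd_foldl P Q K : is_nd (foldl Seq (NChoice P Q) K).
Proof. by elim/last_ind: K => //= K S IH; rewrite !foldl_rcons. Qed.

(* By [nd_state_unique] at most one state [s] qualifies for a given [w]. *)
Definition worst P0 : scheduler := fun w =>
  if `[< exists f s, [/\ steps f (init P0) s, is_nd (st_prog s), st_hist s = w &
    value (resolve NL (st_prog s)) [::] (st_val s) <=
    value (resolve NR (st_prog s)) [::] (st_val s)] >] then NL else NR.

Lemma steps_rcons f s t u : steps f s t -> step f t u -> steps f s u.
Proof.
elim=> {s t} [s su|s t v st _ IH /IH]; last exact: steps_trans.
exact: steps_trans su (steps_refl _ _).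
Qed.

(** Each introduction rule of [guarantee], read as an inequality between values, matches one kind of
    step. Only nondeterministic choice depends on the scheduler: there the branch of smaller value
    has to be the one taken. Reachability is the invariant because it lets the history identify the
    state. *)
Lemma value_superharmonic P0 (f := worst P0) :
  superharmonic f (steps f (init P0))
    (fun s => ratr (st_prob s) * value (st_prog s) [::] (st_val s)).
Proof.
move=> s Hs; have s0 : 0 <= st_prob s by apply: steps_prob_ge0 Hs _.
have rs0 : 0 <= ratr (st_prob s) :> R by rewrite ler0q.
split=> //.
- rewrite /terminal => ->; rewrite -{1}[ratr _]mulr1 ler_wpM2l //.
  by have := guarantee_le_value (guarantee_end (st_val s)); rewrite rmorph1.
- by rewrite mulr_ge0 ?value_ge0.
case: s Hs s0 rs0 => S eta a w /= Hs s0 rs0.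
suff [l [H1 H2]] : exists l : seq state,
    (forall t, step f (State S eta a w) t -> List.In t l) /\
    (forall t, List.In t l -> step f (State S eta a w) t) /\
    \sum_(t <- l) ratr (st_prob t) * value (st_prog t) [::] (st_val t) <=
     ratr a * value S [::] eta.
  by exists l; case: H2 => H2 H3; split=> // t /H2; exact: steps_rcons.
have [P [K [ES HP]]] := foldl_seq_exists S.
have one t : step f (State S eta a w) t ->
    (forall u, step f (State S eta a w) u -> u = t) ->
    ratr (st_prob t) * value (st_prog t) [::] (st_val t) <= ratr a * value S [::] eta ->
    exists l : seq state,
    (forall t, step f (State S eta a w) t -> List.In t l) /\
    (forall t, List.In t l -> step f (State S eta a w) t) /\
    \sum_(t <- l) ratr (st_prob t) * value (st_prog t) [::] (st_val t) <=
     ratr a * value S [::] eta.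
  move=> H1 H2 H3; exists [:: t]; rewrite big_seq1; split=> [u /H2 ->|]; first by left.
  by split=> // u [<-|].
(* For a unique successor with unchanged probability only the two values remain to be compared. *)
have det P' eta' w' : step f (State P eta a w) (State P' eta' a w') ->
    (forall u, step f (State P eta a w) u -> u = State P' eta' a w') -> P <> Bot ->
    value P' K eta' <= value P K eta ->
    exists l : seq state,
    (forall t, step f (State S eta a w) t -> List.In t l) /\
    (forall t, List.In t l -> step f (State S eta a w) t) /\
    \sum_(t <- l) ratr (st_prob t) * value (st_prog t) [::] (st_val t) <=
     ratr a * value S [::] eta.
  move=> st un NB HV; apply: (one (State (foldl Seq P' K) eta' a w')).
  - by rewrite ES; exact: step_foldl.
  - rewrite ES => u /(step_foldl_inv HP)[[//]|[P2 [eta2 [a2 [w2 [H2 ->]]]]]].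
    by case: (un _ H2) => -> -> -> ->.
  - by rewrite /= ES !value_foldl !cats0 ler_wpM2l.
case: P ES HP det => [|v e|//|P p Q|P Q|b P] ES HP det.
- case: K ES {det} => [|Q K] ES.
    exists [::]; rewrite big_nil mulr_ge0 ?value_ge0 //; split=> // t.
    by rewrite ES => /step_Bot.
  apply: (one (State (foldl Seq Q K) eta a w)).
  + rewrite ES; exact/(@step_foldl f (Seq Bot Q))/step_seq_bot.
  + rewrite ES => u /step_foldl_inv[//|[_ [Q' [K' [[-> ->] ->]]]]//|].
    by move=> [P2 [eta2 [a2 [w2 [/step_Bot]]]]].
  + rewrite /= ES (value_foldl Bot (Q :: K)) value_foldl !cats0 ler_wpM2l //.
    by apply: value_mono => q; exact: guarantee_bot.
- apply: (det Bot (upd eta v (aeval eta e)) w) => //; first exact: step_assign.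
    by move=> u H; inversion H.
  by apply: value_mono => q; exact: guarantee_assign.
- have [p0|p0] := leP (aeval eta p) 0.
    apply: (det Q eta (rcons w Rp)) => //; first exact: step_prob_le0.
      by move=> u H; inversion H; subst => //; exfalso; lra.
    by apply: value_mono => q; exact: guarantee_prob_le0.
  have [p1|p1] := leP 1 (aeval eta p).
    apply: (det P eta (rcons w Lp)) => //; first exact: step_prob_ge1.
      by move=> u H; inversion H; subst => //; exfalso; lra.
    by apply: value_mono => q; exact: guarantee_prob_ge1.
  have p01 : 0 < aeval eta p < 1 by rewrite p0.
  exists [:: State (foldl Seq P K) eta (a * aeval eta p) (rcons w Lp);
             State (foldl Seq Q K) eta (a * (1 - aeval eta p)) (rcons w Rp)].
  split; last split.
  + rewrite ES => u /(step_foldl_inv HP)[[//]|[P2 [eta2 [a2 [w2 [H2 ->]]]]]].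
    by case: (step_PChoice_inv p01 H2) => -[-> -> -> ->]; [left|right; left].
  + rewrite ES => u [<-|[<-|//]]; apply: step_foldl.
      exact: step_prob_L.
    exact: step_prob_R.
  + have rM x y : ratr (x * y) = ratr x * ratr y :> R by exact: rmorphM.
    rewrite big_cons big_seq1 /= ES !value_foldl !cats0 !rM.
    rewrite -2![ratr a * _ * _]mulrA -mulrDr.
    by apply: ler_wpM2l; [|exact: value_prob].
(* The test in [worst] concerns some state with history [w] on a run of some scheduler; uniqueness
   identifies it with the current one. *)
- have nd g t : steps g (init P0) t -> is_nd (st_prog t) -> st_hist t = w ->
      t = State S eta a w.
    move=> H1 H2 H3; apply: nd_state_unique H1 Hs H2 _ _ => //=.
    by rewrite ES is_nd_foldl.
  case Ew: (f w).
    apply: (det P eta (rcons w Ln)) => //; first exact: step_nd_L.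
      by move=> u H; inversion H; subst => //; congruence.
    apply: value_nd; move: Ew; rewrite /f /worst; case: asboolP => // -[g [t [H1 H2 H3]]].
    by rewrite (nd _ _ H1 H2 H3) /= ES !resolve_foldl !value_foldl !cats0.
  apply: (det Q eta (rcons w Rn)) => //; first exact: step_nd_R.
    by move=> u H; inversion H; subst => //; congruence.
  rewrite value_nd_sym; apply: value_nd; move: Ew; rewrite /f /worst.
  case: asboolP => // N _; have [H|/ltW //] := leP (value P K eta) (value Q K eta).
  (* The test quantifies over all schedulers, so the run of [worst] itself may serve as its witness
     without circularity. *)
  case: N; exists f, (State S eta a w); split=> //=.
    by rewrite ES is_nd_foldl.
  by rewrite ES !resolve_foldl !value_foldl !cats0.
- case hb: (beval eta b).
    apply: (det (Seq P (While b P)) eta w) => //; first exact: step_while_true.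
      by move=> u H; inversion H; subst => //; exfalso; move: hb; apply/negP.
    by apply: value_mono => q /guarantee_seq_inv; apply: guarantee_while_true.
  move/negbT: hb => hb.
  apply: (det Bot eta w) => //; first exact: step_while_false.
    by move=> u H; inversion H; subst => //; exfalso; move: hb; apply/negP/negPn.
  by apply: value_mono => q; exact: guarantee_while_false.
Qed.

(** A step merely redistributes probability, so [st_prob] is itself superharmonic. This bounds
    termination probabilities by 1, as the equality demanded in AST requires. *)
Lemma successors_prob f P eta a w : 0 <= a -> exists l : seq state,
  [/\ forall t, step f (State P eta a w) t -> List.In t l,
     forall t, List.In t l -> 0 <= st_prob t
   & \sum_(t <- l) ratr (st_prob t) <= ratr a :> R].
Proof.
move=> a0; have one t0 S : (forall t, step f (State S eta a w) t -> t = t0) ->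
    st_prob t0 = a -> exists l : seq state,
    [/\ forall t, step f (State S eta a w) t -> List.In t l,
       forall t, List.In t l -> 0 <= st_prob t
     & \sum_(t <- l) ratr (st_prob t) <= ratr a :> R].
  move=> un E; exists [:: t0]; split=> [t /un ->|t [<-|//]|]; first by left.
    by rewrite E.
  by rewrite big_seq1 E.
elim: P => [|v e|P [l [Hl pl sl]] Q _|P _ p Q _|P _ Q _|b P _].
- by exists [::]; split=> [t /step_Bot//|//|]; rewrite big_nil ler0q.
- apply: (one (State Bot (upd eta v (aeval eta e)) a w)) => // t H.
  by inversion H.
- have [->|NB] := pselect (P = Bot).
    apply: (one (State Q eta a w)) => // t /step_Seq_inv[|[_ ->//]].
    by move=> [P' [eta' [a' [w' [/step_Bot]]]]].
  exists [seq State (Seq (st_prog s) Q) (st_val s) (st_prob s) (st_hist s) | s <- l].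
  split; last by rewrite big_map.
    move=> t /step_Seq_inv[|[//]].
    move=> [P' [eta' [a' [w' [/Hl H ->]]]]].
    by apply/List.in_map_iff; exists (State P' eta' a' w').
  by move=> t /List.in_map_iff[s [<- /pl]].
- have [p0|p0] := leP (aeval eta p) 0.
    apply: (one (State Q eta a (rcons w Rp))) => // t H.
    by inversion H; subst => //; exfalso; lra.
  have [p1|p1] := leP 1 (aeval eta p).
    apply: (one (State P eta a (rcons w Lp))) => // t H.
    by inversion H; subst => //; exfalso; lra.
  have p01 : 0 < aeval eta p < 1 by rewrite p0.
  exists [:: State P eta (a * aeval eta p) (rcons w Lp);
             State Q eta (a * (1 - aeval eta p)) (rcons w Rp)]; split.
  + by move=> t /(step_PChoice_inv p01) [->|->]; [left|right; left].
  + by move=> t [<-|[<-|//]] /=; rewrite mulr_ge0 // ?subr_ge0 ltW.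
  + by rewrite big_cons big_seq1 /= -rmorphD ler_rat -mulrDr addrC subrK mulr1.
- case Ew: (f w).
    apply: (one (State P eta a (rcons w Ln))) => // t H.
    by inversion H; subst => //; congruence.
  apply: (one (State Q eta a (rcons w Rn))) => // t H.
  by inversion H; subst => //; congruence.
- case hb: (beval eta b).
    apply: (one (State (Seq P (While b P)) eta a w)) => // t H.
    by inversion H; subst => //; exfalso; move: hb; apply/negP.
  apply: (one (State Bot eta a w)) => // t H.
  by inversion H; subst => //; exfalso; move/negbT: hb; apply/negP/negPn.
Qed.

Lemma Pr_term_le1 P f : (Pr_term P f <= 1)%E.
Proof.
have := @Pr_from_le_superharmonic f (fun s => 0 <= st_prob s)
  (fun s => ratr (st_prob s)) (init P).
rewrite /= rmorph1; apply; last exact: ler01.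
by move=> s s0; split=> //; [rewrite ler0q|case: s s0 => *; apply: successors_prob].
Qed.

(** If no derivable bound reached 1 - 1/(k+1), the value, and with it the termination probability
    under [worst P], would stay below 1. The converse is soundness for every k. *)
Lemma AST_prog_iff P : AST_prog P <->
  forall k : nat, exists2 q, 1 - k.+1%:R^-1 <= q & guarantee P [::] eta0 q.
Proof.
split=> [ast k|H f]; last first.
  apply: le_anti; rewrite Pr_term_le1 /=; apply/lee_addgt0Pr => e e0.
  have [k Hk] : exists k : nat, k.+1%:R^-1 < e.
    (* One more than the integer part of 1/e exceeds 1/e. *)
    exists (Num.truncn e^-1); rewrite invf_plt ?posrE //.
    exact: truncnS_gt.
  have [q kq /guarantee_le_Pr_from Hq] := H k.
  have := Hq f 1 [::] ler01; rewrite mul1r => {}Hq.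
  have : (1 <= ((ratr q : R) + e)%:E)%E.
    rewrite lee_fin -lerBlDr; apply: le_trans (_ : ratr (1 - k.+1%:R^-1) <= _).
      by rewrite rmorphB rmorph1 fmorphV rmorph_nat lerD2l lerN2 ltW.
    by rewrite ler_rat.
  by move=> /le_trans; apply; rewrite EFinD; apply: leeD2r; exact: Hq.
apply: contrapT => N.
have VP : value P [::] eta0 <= ratr (1 - k.+1%:R^-1).
  apply: value_le => q Hq; rewrite ler_rat; have [//|/ltW kq] := leP q (1 - k.+1%:R^-1).
  by case: N; exists q.
have := Pr_from_le_superharmonic (@value_superharmonic P) (steps_refl _ _).
have -> : Pr_from (worst P) (init P) = 1%E by exact: ast.
rewrite /= lee_fin rmorph1 mul1r => /le_trans /(_ VP); rewrite -(rmorph1 (@ratr R)) ler_rat.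
by rewrite leNgt gtrBl invr_gt0 ltr0Sn.
Qed.

End TerminationGuarantees.

(** * Program codes *)

Ltac prinv := subst; repeat match goal with
  | H : pr _ _ = pr _ _ |- _ => apply pr_inj in H; destruct H
  | H : S _ = S _ |- _ => injection H as H
  end; subst; try discriminate.

Definition exp_graph := lfp (fun x => x = pr 0 1)
  (fun x a b => exists n v, x = pr n.+1 (v + v) /\ a = pr n v /\ b = pr n v).

Lemma sigma1_exp_graph : Sigma1 (fun e => exp_graph (e 0)).
Proof. by apply: sigma1_lfp; sigma. Qed.
#[local] Hint Resolve sigma1_exp_graph : sigma.

Lemma exp_graphP n v : exp_graph (pr n v) <-> v = 2 ^ n.
Proof.
split=> [|->].
  suff H z : exp_graph z -> exists n, z = pr n (2 ^ n).
    by case/H => m E; prinv.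
  elim=> {z} [_ ->|_ _ _ [m [w [-> [-> ->]]]] _ [k E] _ _]; first by exists 0.
  by exists m.+1; prinv; rewrite expnS mul2n addnn.
elim: n => [|n IH]; first exact: lfp_ax.
rewrite expnS mul2n -addnn; apply: (lfp_rule (a := pr n (2 ^ n)) (b := pr n (2 ^ n))) => //.
by exists n, (2 ^ n).
Qed.

Definition sfun (f : env -> nat) := Sigma1 (fun e => e 0 = f (fun i => e i.+1)).

Lemma sfun_poly f : poly_fun f -> sfun f.
Proof. by move=> pf; apply: sigma1_eq; [exact: poly_var|exact: poly_ren]. Qed.

Lemma sigma1_eq_sfun f g : sfun f -> sfun g -> Sigma1 (fun e => f e = g e).
Proof.
move=> sf sg; apply: (@sigma1_iff _ (fun e => exists x, x = f e /\ x = g e)).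
  by move=> e; split=> [->|[x [<- <-]] //]; exists (g e).
by apply: sigma1_ex; apply: sigma1_and.
Qed.

Lemma sigma1_app_sfun (L : nat -> Prop) f :
  Sigma1 (fun e => L (e 0)) -> sfun f -> Sigma1 (fun e => L (f e)).
Proof.
move=> sL sf; apply: (@sigma1_iff _ (fun e => exists x, x = f e /\ L x)).
  by move=> e; split=> [?|[x [-> //]]]; exists (f e).
by apply: sigma1_ex; apply: sigma1_and => //; exact: (sigma1_ren (fun _ => 0) sL).
Qed.

Lemma sfun_comp2 (op : nat -> nat -> nat) f g :
  Sigma1 (fun e => e 0 = op (e 1) (e 2)) ->
  sfun f -> sfun g -> sfun (fun e => op (f e) (g e)).
Proof.
move=> sop sf sg; rewrite /sfun.
apply: (@sigma1_iff _ (fun e => exists a b, a = f (fun i => e i.+1) /\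
  b = g (fun i => e i.+1) /\ e 0 = op a b)).
  move=> e; split=> [->|[a [b [-> [-> ->]]]] //].
  by exists (f (fun i => e i.+1)), (g (fun i => e i.+1)).
do 2!apply: sigma1_ex; do 2?apply: sigma1_and.
- exact: (sigma1_ren (fun i => if i is i'.+1 then i'.+3 else 1) sf).
- exact: (sigma1_ren (fun i => if i is i'.+1 then i'.+3 else 0) sg).
- exact: (sigma1_ren (fun i => match i with 0 => 2 | 1 => 1 | _ => 0 end) sop).
Qed.

Lemma sfun_pr f g : sfun f -> sfun g -> sfun (fun e => pr (f e) (g e)).
Proof. by apply: sfun_comp2; sigma. Qed.

(* The list constructor of CodeSeq.code. *)
Definition cc : nat -> nat -> nat := locked (fun a m => 2 ^ a * m.*2.+1).

Lemma ccE a m : cc a m = 2 ^ a * m.*2.+1.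
Proof. by rewrite /cc -lock. Qed.

Lemma sfun_cc f g : sfun f -> sfun g -> sfun (fun e => cc (f e) (g e)).
Proof.
apply: sfun_comp2.
apply: (@sigma1_iff _ (fun e => exists p, exp_graph (pr (e 1) p) /\
  e 0 = p * (e 2 + e 2).+1)); last by sigma.
move=> e; rewrite ccE -addnn; split=> [->|[p [/exp_graphP -> ->//]]].
by exists (2 ^ e 1); split=> //; apply/exp_graphP.
Qed.

Ltac sfun := first [apply: sfun_poly; poly | apply: sfun_cc; sfun | apply: sfun_pr; sfun].

(** Extended to equations between sides containing [cc]: these are exponential rather than
    polynomial and are handled through their Sigma_1 graphs. *)
Ltac sigma ::= cbv beta; first
  [ apply: sigma1_ex; sigma
  | apply: sigma1_and; sigma
  | apply: sigma1_or; sigma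
  | apply: sigma1_eq; poly
  | apply: sigma1_eq_sfun; sfun
  | apply: sigma1_le; poly
  | solve [auto 1 with sigma nocore]
  | apply: sigma1_app_sfun; [solve [auto 1 with sigma nocore] | sfun]
  | idtac ].

(** Pickles of [inl] and [inr]: a sum is pickled as a pair of options, a pair as a list of two
    codes, an option as a list of length at most one. The final 1 is [cc 0 0]. *)
Notation tl k := (cc (cc k 0) 1).
Notation tr k := (cc 0 (cc (cc k 0) 0)).

Lemma pickle_inl (S T : countType) (x : S) :
  pickle (inl x : S + T)%type = tl (pickle x).
Proof. by rewrite !ccE. Qed.

Lemma pickle_inr (S T : countType) (x : T) :
  pickle (inr x : S + T)%type = tr (pickle x).
Proof. by rewrite !ccE. Qed.

Lemma pickle_rat (q : rat) :
  pickle q = cc (pickle (numq q)) (cc (pickle (denq q)) 0).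
Proof. by rewrite !ccE. Qed.

Lemma pickle_Posz n : pickle (Posz n) = tl n.
Proof. exact: (@pickle_inl nat nat). Qed.

Lemma pickle_Negz n : pickle (Negz n) = tr n.
Proof. exact: (@pickle_inr nat nat). Qed.

(** [pr (pr a b) c] stands for (a - b)/(c + 1): signs become differences, and no denominator
    vanishes. [Negz n] is -(n + 1). *)
Definition encq (q : rat) := match numq q with
  | Posz n => pr (pr n 0) `|denq q|%N.-1
  | Negz n => pr (pr 0 n.+1) `|denq q|%N.-1
  end.

(* The last conjunct is Bezout's form of coprimality, which is existential. *)
Definition is_rat x v := exists n d,
  ((x = pr (pr n 0) d /\ v = cc (tl n) (cc (tl d.+1) 0)) \/
   (exists m, n = m.+1 /\ x = pr (pr 0 n) d /\ v = cc (tr m) (cc (tl d.+1) 0))) /\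
  ((n = 0 /\ d = 0) \/ exists s t, s * n = t * d.+1 + 1).

(** For n = 0 the equation has no solution, its sides being 0 and positive, although 0 is coprime to
    1; hence the separate disjunct. *)
Lemma bezout_coprime n d : coprime n d.+1 <->
  (n = 0 /\ d = 0) \/ exists s t, s * n = t * d.+1 + 1.
Proof.
split=> [|[[-> ->] //|[s [t E]]]].
  case: n => [|n]; first by rewrite /coprime gcd0n => /eqP [->]; left.
  rewrite /coprime => /eqP E; right.
  by case: (@egcdnP n.+1 d.+1) => // s t; rewrite E => H _; exists s, t.
rewrite /coprime; set g := gcdn _ _; rewrite -dvdn1.
by rewrite -(@dvdn_addr (t * d.+1)) -?E dvdn_mull // ?dvdn_gcdl ?dvdn_gcdr.
Qed.

Lemma is_ratP x v : is_rat x v <-> exists q, x = encq q /\ v = pickle q.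
Proof.
split=> [[n [d [H /bezout_coprime cop]]]|[q [-> ->]]].
  case: H => [[-> ->]|[m [E [-> ->]]]].
    have P : (0 < (Posz n, Posz d.+1).2)%R && coprime `|(Posz n, Posz d.+1).1|%N `|(Posz n, Posz d.+1).2|%N by [].
    by exists (Rat P); rewrite pickle_rat !pickle_Posz.
  have P : (0 < (Negz m, Posz d.+1).2)%R && coprime `|(Negz m, Posz d.+1).1|%N `|(Negz m, Posz d.+1).2|%N by rewrite /= -E.
  by exists (Rat P); rewrite pickle_rat pickle_Negz pickle_Posz E.
have := coprime_num_den q; rewrite pickle_rat /encq.
have := denq_gt0 q; case: (denq q) => // -[//|d] _.
case: (numq q) => n /= /bezout_coprime cop.
  by exists n, d; rewrite !pickle_Posz; split=> //; left.
rewrite pickle_Negz pickle_Posz.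
by exists n.+1, d; split=> //; right; exists n.
Qed.

(* Programs are recoded with [pr], which makes the evaluation rules polynomial;
   [tokens_p] relates this coding to [code]. *)
Fixpoint enc_a (e : aexp) : nat :=
  match e with
  | AConst q => pr 0 (encq q)
  | AVar v => pr 1 v
  | AAdd a b => pr 2 (pr (enc_a a) (enc_a b))
  | ASub a b => pr 3 (pr (enc_a a) (enc_a b))
  | AMul a b => pr 4 (pr (enc_a a) (enc_a b))
  | ADiv a b => pr 5 (pr (enc_a a) (enc_a b))
  end.

Fixpoint enc_b (b : bexp) : nat :=
  match b with
  | BTrue => pr 0 0
  | BFalse => pr 1 0
  | BEq a c => pr 2 (pr (enc_a a) (enc_a c))
  | BLe a c => pr 3 (pr (enc_a a) (enc_a c))
  | BLt a c => pr 4 (pr (enc_a a) (enc_a c))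
  | BNot c => pr 5 (enc_b c)
  | BAnd c d => pr 6 (pr (enc_b c) (enc_b d))
  | BOr c d => pr 7 (pr (enc_b c) (enc_b d))
  end.

Fixpoint enc_p (P : prog) : nat :=
  match P with
  | Bot => pr 0 0
  | Assign v e => pr 1 (pr v (enc_a e))
  | Seq P1 P2 => pr 2 (pr (enc_p P1) (enc_p P2))
  | PChoice P1 p P2 => pr 3 (pr (enc_p P1) (pr (enc_a p) (enc_p P2)))
  | NChoice P1 P2 => pr 4 (pr (enc_p P1) (enc_p P2))
  | While b P1 => pr 5 (pr (enc_b b) (enc_p P1))
  end.

(** The accumulator [m] is the code of whatever follows the tree, so subtrees are chained without
    concatenating coded lists. [inl k.+1] opens a node labelled [k] and [inl 0] closes it. *)
Definition tokens (t : GenTree.tree leaf) m := foldr cc m (map pickle (GenTree.encode t)).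

Lemma tokens_leaf (x : leaf) m : tokens (GenTree.Leaf x) m = cc (tr (pickle x)) m.
Proof. by rewrite /tokens /= pickle_inr. Qed.

Lemma tokens_node k ts m :
  tokens (GenTree.Node k ts) m = cc (tl k.+1) (foldr tokens (cc (tl 0) m) ts).
Proof.
rewrite /tokens /= map_rcons -cats1 foldr_cat /= !pickle_inl; congr cc.
elim: ts => //= t ts IH; rewrite map_cat foldr_cat; congr foldr; exact: IH.
Qed.

Lemma code_tokens P : code P = tokens (enc_prog P) 0.
Proof.
have E : cc = fun a m => 2 ^ a * m.*2.+1.
  by apply/funext => a; apply/funext => m; exact: ccE.
by rewrite /tokens E.
Qed.

(** Triples of a recoded expression, the code [m] of the rest, and the resulting token list. Lists
    grow from the back: the right operand is put before the closing token, the left operand before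
    the result. One rule serves the four operators. *)
Definition tokens_a := lfp
  (fun z => (exists q m v, is_rat q v /\ z = pr (pr 0 q) (pr m (cc (tr (tl v)) m))) \/
    (exists v m, z = pr (pr 1 v) (pr m (cc (tr (tr v)) m))))
  (fun z a b => exists k x y m u w, k <= 3 /\
    a = pr y (pr (cc (tl 0) m) u) /\ b = pr x (pr u w) /\
    z = pr (pr k.+2 (pr x y)) (pr m (cc (tl k.+1) w))).

Lemma sigma1_tokens_a : Sigma1 (fun e => tokens_a (e 0)).
Proof. by rewrite /tokens_a /is_rat; apply: sigma1_lfp; sigma. Qed.
#[local] Hint Resolve sigma1_tokens_a : sigma.

Lemma tokens_aP x m v : tokens_a (pr x (pr m v)) <->
  exists e, x = enc_a e /\ v = tokens (enc_aexp e) m.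
Proof.
split=> [H|[e [-> ->]] {x v}].
  suff Hz z : tokens_a z ->
      exists e m, z = pr (enc_a e) (pr m (tokens (enc_aexp e) m)).
    by case/Hz: H => e [m' E]; prinv; exists e.
  elim=> {x m v H}{}z => [|a b [k [x [y [m [u [w [k3 [-> [-> ->]]]]]]]]]]; last first.
    move=> _ [ea [ma Ea]] _ [eb [mb Eb]]; prinv.
    case: k k3 => [|[|[|[|//]]]] _; [exists (AAdd eb ea)|exists (ASub eb ea)
      |exists (AMul eb ea)|exists (ADiv eb ea)]; exists m; by rewrite tokens_node.
  case=> [[q [m [v [/is_ratP[r [-> ->]] ->]]]]|[v [m ->]]].
    by exists (AConst r), m; rewrite tokens_leaf pickle_inl.
  by exists (AVar v), m; rewrite tokens_leaf pickle_inr.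
have node k x y m' u w : k <= 3 -> tokens_a (pr y (pr (cc (tl 0) m') u)) ->
    tokens_a (pr x (pr u w)) ->
    tokens_a (pr (pr k.+2 (pr x y)) (pr m' (cc (tl k.+1) w))).
  by move=> k3 Hy Hx; apply: (lfp_rule _ Hy Hx); exists k, x, y, m', u, w.
elim: e m => [q|v|a IHa b IHb|a IHa b IHb|a IHa b IHb|a IHa b IHb] m.
- rewrite tokens_leaf pickle_inl; apply: lfp_ax; left.
  by exists (encq q), m, (pickle q); split=> //; apply/is_ratP; exists q.
- by rewrite tokens_leaf pickle_inr; apply: lfp_ax; right; exists v, m.
- rewrite tokens_node; apply: (node 0 _ _ _ _ _ isT); [exact: IHb|exact: IHa].
- rewrite tokens_node; apply: (node 1 _ _ _ _ _ isT); [exact: IHb|exact: IHa].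
- rewrite tokens_node; apply: (node 2 _ _ _ _ _ isT); [exact: IHb|exact: IHa].
- rewrite tokens_node; apply: (node 3 _ _ _ _ _ isT); [exact: IHb|exact: IHa].
Qed.

(** Comparisons are axioms here, since their operands belong to the Sigma_1 predicate [tokens_a];
    only boolean subexpressions count as premises. *)
Definition tokens_b := lfp
  (fun z => (exists k m, k <= 1 /\
       z = pr (pr k 0) (pr m (cc (tl k.+1) (cc (tl 0) m)))) \/
    (exists k x y m u w, k <= 2 /\
       tokens_a (pr y (pr (cc (tl 0) m) u)) /\ tokens_a (pr x (pr u w)) /\
       z = pr (pr k.+2 (pr x y)) (pr m (cc (tl k.+3) w))))
  (fun z a b => (exists x m w, a = pr x (pr (cc (tl 0) m) w) /\ b = a /\
       z = pr (pr 5 x) (pr m (cc (tl 6) w))) \/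
    (exists k x y m u w, (6 <= k /\ k <= 7) /\
       a = pr y (pr (cc (tl 0) m) u) /\ b = pr x (pr u w) /\
       z = pr (pr k (pr x y)) (pr m (cc (tl k.+1) w)))).

Lemma sigma1_tokens_b : Sigma1 (fun e => tokens_b (e 0)).
Proof. by apply: sigma1_lfp; sigma. Qed.
#[local] Hint Resolve sigma1_tokens_b : sigma.

Lemma tokens_bP x m v : tokens_b (pr x (pr m v)) <->
  exists e, x = enc_b e /\ v = tokens (enc_bexp e) m.
Proof.
split=> [H|[e [-> ->]] {x v}].
  suff Hz z : tokens_b z ->
      exists e m, z = pr (enc_b e) (pr m (tokens (enc_bexp e) m)).
    by case/Hz: H => e [m' E]; prinv; exists e.
  elim=> {x m v H}{}z => [|a b].
    case=> [[k [m [k1 ->]]]|[k [x [y [m [u [w [k2 [/tokens_aP[ey [-> ->]]]]]]]]]]].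
      case: k k1 => [|[|//]] _; [exists BTrue|exists BFalse]; exists m;
      by rewrite tokens_node.
    move=> [/tokens_aP[ex [-> ->]] ->].
    case: k k2 => [|[|[|//]]] _; [exists (BEq ex ey)|exists (BLe ex ey)
      |exists (BLt ex ey)]; exists m; by rewrite tokens_node.
  case=> [[x [m [w [-> [-> ->]]]]]|[k [x [y [m [u [w [k67 [-> [-> ->]]]]]]]]]].
    move=> _ [ea [ma Ea]] _ _; prinv.
    by exists (BNot ea), m; rewrite tokens_node.
  move=> _ [ea [ma Ea]] _ [eb [mb Eb]]; prinv.
  have {k67}[->|->] : k = 6 \/ k = 7 by lia.
    by exists (BAnd eb ea), m; rewrite tokens_node.
  by exists (BOr eb ea), m; rewrite tokens_node.
have cmp k a b m' : k <= 2 ->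
    tokens_b (pr (pr k.+2 (pr (enc_a a) (enc_a b))) (pr m' (cc (tl k.+3)
      (tokens (enc_aexp a) (tokens (enc_aexp b) (cc (tl 0) m')))))).
  move=> k2; apply: lfp_ax; right.
  exists k, (enc_a a), (enc_a b), m', (tokens (enc_aexp b) (cc (tl 0) m')),
    (tokens (enc_aexp a) (tokens (enc_aexp b) (cc (tl 0) m'))).
  by split=> //; split; [apply/tokens_aP; exists b|split=> //; apply/tokens_aP; exists a].
have bin k x' y' m' u w : 6 <= k <= 7 -> tokens_b (pr y' (pr (cc (tl 0) m') u)) ->
    tokens_b (pr x' (pr u w)) ->
    tokens_b (pr (pr k (pr x' y')) (pr m' (cc (tl k.+1) w))).
  move=> /andP[k6 k7] Hy Hx; apply: (lfp_rule _ Hy Hx).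
  by right; exists k, x', y', m', u, w.
elim: e m => [||a b|a b|a b|b IHb|a IHa b IHb|a IHa b IHb] m; rewrite tokens_node.
- by apply: lfp_ax; left; exists 0, m.
- by apply: lfp_ax; left; exists 1, m.
- exact: (@cmp 0).
- exact: (@cmp 1).
- exact: (@cmp 2).
- apply: (lfp_rule _ (IHb (cc (tl 0) m)) (IHb (cc (tl 0) m))); left.
  by exists (enc_b b), m, (tokens (enc_bexp b) (cc (tl 0) m)).
- apply: (bin 6 _ _ _ _ _ isT); [exact: IHb|exact: IHa].
- apply: (bin 7 _ _ _ _ _ isT); [exact: IHb|exact: IHa].
Qed.

Definition tokens_p := lfp
  (fun z => (exists m, z = pr (pr 0 0) (pr m (cc (tl 1) (cc (tl 0) m)))) \/
    (exists v x m u, tokens_a (pr x (pr (cc (tl 0) m) u)) /\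
       z = pr (pr 1 (pr v x)) (pr m (cc (tl 2) (cc (tr (tr v)) u)))))
  (fun z a b => (exists k x y m u w, (k = 2 \/ k = 4) /\
       a = pr y (pr (cc (tl 0) m) u) /\ b = pr x (pr u w) /\
       z = pr (pr k (pr x y)) (pr m (cc (tl k.+1) w))) \/
    (exists x p y m u v w, tokens_a (pr p (pr u v)) /\
       a = pr y (pr (cc (tl 0) m) u) /\ b = pr x (pr v w) /\
       z = pr (pr 3 (pr x (pr p y))) (pr m (cc (tl 4) w))) \/
    (exists x y m u w, tokens_b (pr x (pr u w)) /\
       a = pr y (pr (cc (tl 0) m) u) /\ b = a /\
       z = pr (pr 5 (pr x y)) (pr m (cc (tl 6) w)))).

Lemma sigma1_tokens_p : Sigma1 (fun e => tokens_p (e 0)).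
Proof. by apply: sigma1_lfp; sigma. Qed.
#[local] Hint Resolve sigma1_tokens_p : sigma.

Lemma tokens_pP x m v : tokens_p (pr x (pr m v)) <->
  exists P, x = enc_p P /\ v = tokens (enc_prog P) m.
Proof.
split=> [H|[e [-> ->]] {x v}].
  suff Hz z : tokens_p z ->
      exists e m, z = pr (enc_p e) (pr m (tokens (enc_prog e) m)).
    by case/Hz: H => e [m' E]; prinv; exists e.
  elim=> {x m v H}{}z => [|a b].
    case=> [[m ->]|[v [x [m [u [/tokens_aP[e [-> ->]] ->]]]]]].
      by exists Bot, m; rewrite tokens_node.
    by exists (Assign v e), m; rewrite tokens_node /= tokens_leaf pickle_inr.
  case=> [[k [x [y [m [u [w [k24 [-> [-> ->]]]]]]]]]|[]].
  - move=> _ [ea [ma Ea]] _ [eb [mb Eb]]; prinv.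
    case: k24 => ->; first by exists (Seq eb ea), m; rewrite tokens_node.
    by exists (NChoice eb ea), m; rewrite tokens_node.
  - move=> [x [p [y [m [u [v [w [/tokens_aP[e [-> ->]] [-> [-> ->]]]]]]]]]].
    move=> _ [ea [ma Ea]] _ [eb [mb Eb]]; prinv.
    by exists (PChoice eb e ea), m; rewrite tokens_node.
  - move=> [x [y [m [u [w [/tokens_bP[e [-> ->]] [-> [-> ->]]]]]]]].
    move=> _ [ea [ma Ea]] _ _; prinv.
    by exists (While e ea), m; rewrite tokens_node.
have bin k x' y' m' u w : k = 2 \/ k = 4 -> tokens_p (pr y' (pr (cc (tl 0) m') u)) ->
    tokens_p (pr x' (pr u w)) ->
    tokens_p (pr (pr k (pr x' y')) (pr m' (cc (tl k.+1) w))).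
  move=> k24 Hy Hx; apply: (lfp_rule _ Hy Hx).
  by left; exists k, x', y', m', u, w.
elim: e m => [|v e|P IHP Q IHQ|P IHP p Q IHQ|P IHP Q IHQ|b P IHP] m;
  rewrite tokens_node.
- by apply: lfp_ax; left; exists m.
- rewrite /= tokens_leaf pickle_inr; apply: lfp_ax; right; exists v, (enc_a e), m, (tokens (enc_aexp e) (cc (tl 0) m)).
  by split=> //; apply/tokens_aP; exists e.
- apply: (bin 2); [by left|exact: IHQ|exact: IHP].
- have HQ := IHQ (cc (tl 0) m).
  have HP := IHP (tokens (enc_aexp p) (tokens (enc_prog Q) (cc (tl 0) m))).
  apply: (lfp_rule _ HQ HP); right; left.
  do 3!eexists; exists m; do 3!eexists; split; last by do !split.
  by apply/tokens_aP; exists p.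
- apply: (bin 4); [by right|exact: IHQ|exact: IHP].
- have HP := IHP (cc (tl 0) m); apply: (lfp_rule _ HP HP); right; right.
  exists (enc_b b), (enc_p P), m, (tokens (enc_prog P) (cc (tl 0) m)).
  exists (tokens (enc_bexp b) (tokens (enc_prog P) (cc (tl 0) m))).
  by split=> //; apply/tokens_bP; exists b.
Qed.

(** * Evaluation on codes *)

(* Codes of rationals need not be reduced. *)
Definition codes_rat x (q : rat) := exists a b c : nat,
  x = pr (pr a b) c /\ q = ((a%:R - b%:R) / c.+1%:R)%R.

Notation code0 := (pr (pr 0 0) 0).
Notation code1 := (pr (pr 1 0) 0).

Lemma codes_rat0 : codes_rat code0 0%R.
Proof. by exists 0, 0, 0. Qed.

Lemma codes_rat1 : codes_rat code1 1%R.
Proof. by exists 1, 0, 0. Qed.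

Lemma codes_rat_enc q : codes_rat (encq q) q.
Proof.
rewrite -[X in codes_rat _ X]divq_num_den /encq; have := denq_gt0 q.
case: (denq q) => // -[//|d] _; case: (numq q) => n.
  by exists n, 0, d; rewrite subr0.
by exists 0, n.+1, d; rewrite sub0r NegzE mulrNz.
Qed.

(** Sum, difference, product and quotient of fractions. As (c+1)(c'+1) is one more than cc' + c +
    c', the latter codes the common denominator. Division splits on the sign of the divisor, written
    t + 1 or its negative; the zero divisor yields 0, as in the semantics. *)
Definition rop k x y z := exists a b c a' b' c',
  x = pr (pr a b) c /\ y = pr (pr a' b') c' /\
  ((k = 0 /\ z = pr (pr (a * c'.+1 + a' * c.+1) (b * c'.+1 + b' * c.+1))
                    (c * c' + c + c')) \/
   (k = 1 /\ z = pr (pr (a * c'.+1 + b' * c.+1) (b * c'.+1 + a' * c.+1))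
                    (c * c' + c + c')) \/
   (k = 2 /\ z = pr (pr (a * a' + b * b') (a * b' + b * a')) (c * c' + c + c')) \/
   (k = 3 /\ ((a' = b' /\ z = code0) \/
     (exists t, a' = b' + t.+1 /\ z = pr (pr (a * c'.+1) (b * c'.+1)) (c * t + c + t)) \/
     (exists t, b' = a' + t.+1 /\ z = pr (pr (b * c'.+1) (a * c'.+1)) (c * t + c + t))))).

Definition ratop k (q r : rat) : rat :=
  match k with 0 => q + r | 1 => q - r | 2 => q * r | _ => q / r end%R.

Lemma rop_sound k x y z q r :
  rop k x y z -> codes_rat x q -> codes_rat y r -> codes_rat z (ratop k q r).
Proof.
move=> [a [b [c [a' [b' [c' [-> [-> H]]]]]]]].
move=> [a1 [b1 [c1 [E1 ->]]]] [a2 [b2 [c2 [E2 ->]]]]; prinv.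
have nz n : (n.+1%:R : rat) != 0%R by rewrite pnatr_eq0.
have denE s t : s * t + s + t = (s.+1 * t.+1).-1 by lia.
case: H => [[-> ->]|[[-> ->]|[[-> ->]|[-> H]]]].
- do 3!eexists; split; first by [].
  rewrite denE prednK // !natrD !natrM /=.
  by move: (nz c1) (nz c2); move: (c1.+1%:R)%R (c2.+1%:R)%R => C1 C2 *; field; apply/andP.
- do 3!eexists; split; first by [].
  rewrite denE prednK // !natrD !natrM /=.
  by move: (nz c1) (nz c2); move: (c1.+1%:R)%R (c2.+1%:R)%R => C1 C2 *; field; apply/andP.
- do 3!eexists; split; first by [].
  rewrite denE prednK // !natrD !natrM /=.
  by move: (nz c1) (nz c2); move: (c1.+1%:R)%R (c2.+1%:R)%R => C1 C2 *; field; apply/andP.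
- case: H => [[-> ->]|[[t [-> ->]]|[t [-> ->]]]].
  + by rewrite subrr mul0r /= invr0 mulr0; exact: codes_rat0.
  + do 3!eexists; split; first by [].
    rewrite denE prednK // !natrD !natrM /= [(b2%:R + _)%R]addrC addrK.
    move: (nz c1) (nz c2) (nz t).
    by move: (c1.+1%:R)%R (c2.+1%:R)%R (t.+1%:R)%R => C1 C2 T *; field; do !(apply/andP; split).
  + do 3!eexists; split; first by [].
    rewrite denE prednK // !natrD !natrM /= opprD addrA subrr sub0r.
    move: (nz c1) (nz c2) (nz t).
    by move: (c1.+1%:R)%R (c2.+1%:R)%R (t.+1%:R)%R => C1 C2 T *; field; do !(apply/andP; split).
Qed.

Lemma rop_total k x y q r : k <= 3 -> codes_rat x q -> codes_rat y r -> exists z, rop k x y z.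
Proof.
move=> k3 [a [b [c [-> _]]]] [a' [b' [c' [-> _]]]].
have wit z : ((k = 0 /\ z = pr (pr (a * c'.+1 + a' * c.+1) (b * c'.+1 + b' * c.+1))
                    (c * c' + c + c')) \/
   (k = 1 /\ z = pr (pr (a * c'.+1 + b' * c.+1) (b * c'.+1 + a' * c.+1))
                    (c * c' + c + c')) \/
   (k = 2 /\ z = pr (pr (a * a' + b * b') (a * b' + b * a')) (c * c' + c + c')) \/
   (k = 3 /\ ((a' = b' /\ z = code0) \/
     (exists t, a' = b' + t.+1 /\ z = pr (pr (a * c'.+1) (b * c'.+1)) (c * t + c + t)) \/
     (exists t, b' = a' + t.+1 /\ z = pr (pr (b * c'.+1) (a * c'.+1)) (c * t + c + t))))) ->
  exists z, rop k (pr (pr a b) c) (pr (pr a' b') c') z.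
  by move=> H; exists z, a, b, c, a', b', c'.
case: k k3 wit => [|[|[|[|//]]]] _ wit.
- by apply: wit; left.
- by apply: wit; right; left.
- by apply: wit; right; right; left.
have [lt|lt|E] := ssrnat.ltngtP a' b'.
- apply: wit; do 3!right; split=> //; right; right; exists (b' - a').-1.
  by split; [lia|].
- apply: wit; do 3!right; split=> //; right; left; exists (a' - b').-1.
  by split; [lia|].
- apply: wit; do 3!right; split; first exact: erefl.
  left; split; [exact: E|exact: erefl].
Qed.

Definition rle x y := exists a b c a' b' c',
  x = pr (pr a b) c /\ y = pr (pr a' b') c' /\
  a * c'.+1 + b' * c.+1 <= a' * c.+1 + b * c'.+1.

Definition rlt x y := exists a b c a' b' c',
  x = pr (pr a b) c /\ y = pr (pr a' b') c' /\
  (a * c'.+1 + b' * c.+1).+1 <= a' * c.+1 + b * c'.+1.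

Lemma frac_le (a b c a' b' c' : nat) :
  (((a%:R - b%:R) / c.+1%:R : rat) <= (a'%:R - b'%:R) / c'.+1%:R)%R =
  (a * c'.+1 + b' * c.+1 <= a' * c.+1 + b * c'.+1).
Proof.
rewrite ler_pdivrMr ?ltr0Sn // mulrAC ler_pdivlMr ?ltr0Sn //.
by rewrite -(ler_nat rat) !natrD !natrM !mulrBl lerBlDr addrAC lerBrDr.
Qed.

Lemma rleP x y q r : codes_rat x q -> codes_rat y r -> rle x y <-> (q <= r)%R.
Proof.
move=> [a1 [b1 [c1 [-> ->]]]] [a2 [b2 [c2 [-> ->]]]]; rewrite frac_le.
split=> [[a [b [c [a' [b' [c' [E1 [E2 H]]]]]]]]|H]; first by prinv.
by exists a1, b1, c1, a2, b2, c2.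
Qed.

Lemma rltP x y q r : codes_rat x q -> codes_rat y r -> rlt x y <-> (q < r)%R.
Proof.
move=> [a1 [b1 [c1 [-> ->]]]] [a2 [b2 [c2 [-> ->]]]]; rewrite ltNge frac_le -ltnNge.
split=> [[a [b [c [a' [b' [c' [E1 [E2 H]]]]]]]]|H]; first by prinv; lia.
by exists a1, b1, c1, a2, b2, c2; do 2!split=> //; lia.
Qed.

(** Sigma_1 is not closed under negation, so the outcome 0 is described by a positive condition of
    its own. *)
Definition rcmp k x y t :=
  (k = 0 /\ ((t = 1 /\ rle x y /\ rle y x) \/ (t = 0 /\ (rlt x y \/ rlt y x)))) \/
  (k = 1 /\ ((t = 1 /\ rle x y) \/ (t = 0 /\ rlt y x))) \/
  (k = 2 /\ ((t = 1 /\ rlt x y) \/ (t = 0 /\ rle y x))).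

Definition ratcmp k (q r : rat) : bool :=
  match k with 0 => q == r | 1 => (q <= r)%R | _ => (q < r)%R end.

Lemma rcmpP k x y t q r : k <= 2 -> codes_rat x q -> codes_rat y r ->
  rcmp k x y t <-> t = ratcmp k q r.
Proof.
move=> k2 Hx Hy; rewrite /rcmp !(rleP Hx Hy, rleP Hy Hx, rltP Hx Hy, rltP Hy Hx).
case: k k2 => [|[|[|//]]] _ /=; case: (ltgtP q r) => _; lia.
Qed.

(** Valuations met in a run differ from [eta0] at finitely many variables and are coded, not
    uniquely, by their list of updates. *)
Inductive codes_val : nat -> valuation -> Prop :=
| codes_val_nil : codes_val 0 eta0
| codes_val_cons l eta v x q : codes_val l eta -> codes_rat x q ->
    codes_val (pr (pr v x) l).+1 (upd eta v q).

(** The latest update comes first; distinctness of variables is stated through the order, again to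
    avoid negation. *)
Definition lookup := lfp
  (fun z => (exists v, z = pr 0 (pr v code0)) \/
    (exists v x l, z = pr (pr (pr v x) l).+1 (pr v x)))
  (fun z a b => exists v v' x x' l, (v.+1 <= v' \/ v'.+1 <= v) /\
    a = pr l (pr v x) /\ b = a /\ z = pr (pr (pr v' x') l).+1 (pr v x)).

Lemma sigma1_lookup : Sigma1 (fun e => lookup (e 0)).
Proof. by apply: sigma1_lfp; sigma. Qed.
#[local] Hint Resolve sigma1_lookup : sigma.

Lemma lookup_sound l v x eta :
  lookup (pr l (pr v x)) -> codes_val l eta -> codes_rat x (eta v).
Proof.
move E: (pr l (pr v x)) => z H; elim: H l v x eta E => {z} [z|z a b].
  case=> [[v' ->]|[v' [x' [l' ->]]]] l v x eta E V; prinv.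
    by inversion V; exact: codes_rat0.
  by inversion V; prinv; rewrite /upd eqxx.
move=> [v' [v2 [x' [x2 [l' [N [-> [-> ->]]]]]]]] _ IH _ _ l v x eta E V; prinv.
inversion V; prinv; rewrite /upd; case: eqP => [E|_]; first by lia.
exact: IH.
Qed.

Lemma lookup_total l eta v : codes_val l eta -> exists x, lookup (pr l (pr v x)).
Proof.
elim=> [|{}l {}eta v' x' q V [x IH] R].
  by exists code0; apply: lfp_ax; left; exists v.
have [lt|lt|->] := ssrnat.ltngtP v v'.
- by exists x; apply: (lfp_rule _ IH IH); exists v, v', x, x', l; split=> //; left.
- by exists x; apply: (lfp_rule _ IH IH); exists v, v', x, x', l; split=> //; right.
- by exists x'; apply: lfp_ax; right; exists v', x', l.
Qed.

Definition aeval_graph := lfp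
  (fun z => (exists q l, z = pr (pr 0 q) (pr l q)) \/
    (exists v l x, lookup (pr l (pr v x)) /\ z = pr (pr 1 v) (pr l x)))
  (fun z a b => exists k e1 e2 l x1 x2 x, k <= 3 /\ rop k x1 x2 x /\
    a = pr e1 (pr l x1) /\ b = pr e2 (pr l x2) /\
    z = pr (pr k.+2 (pr e1 e2)) (pr l x)).

Lemma sigma1_aeval_graph : Sigma1 (fun e => aeval_graph (e 0)).
Proof. by apply: sigma1_lfp; rewrite /rop; sigma. Qed.
#[local] Hint Resolve sigma1_aeval_graph : sigma.

Lemma aeval_sound e l x eta :
  aeval_graph (pr (enc_a e) (pr l x)) -> codes_val l eta -> codes_rat x (aeval eta e).
Proof.
move E: (pr _ _) => z H; elim: H e l x eta E => {z} [z|z a b].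
  case=> [[q [l' ->]]|[v [l' [x' [H ->]]]]] e l x eta E V; prinv;
    destruct e; simpl in *; prinv; first exact: codes_rat_enc.
  exact: lookup_sound H V.
move=> [k [e1 [e2 [l' [x1 [x2 [x' [k3 [R [-> [-> ->]]]]]]]]]]] _ IHa _ IHb.
move=> e l x eta E V; prinv.
have sem f1 f2 : e1 = enc_a f1 -> e2 = enc_a f2 ->
    codes_rat x' (ratop k (aeval eta f1) (aeval eta f2)).
  by move=> E1 E2; apply: rop_sound R _ _; [apply: IHa|apply: IHb]; rewrite ?E1 ?E2.
by destruct e; simpl in *; prinv; apply: sem.
Qed.

(** A rational has many codes, so completeness takes this form: some code is computed, and by
    [aeval_sound] it is a correct one. *)
Lemma aeval_total e l eta : codes_val l eta ->
  exists x, aeval_graph (pr (enc_a e) (pr l x)).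
Proof.
move=> V; have bin k e1 e2 : k <= 3 ->
    (exists x, aeval_graph (pr (enc_a e1) (pr l x))) ->
    (exists x, aeval_graph (pr (enc_a e2) (pr l x))) ->
    exists x, aeval_graph (pr (pr k.+2 (pr (enc_a e1) (enc_a e2))) (pr l x)).
  move=> k3 [x1 H1] [x2 H2].
  have [x Hx] := rop_total k3 (aeval_sound H1 V) (aeval_sound H2 V).
  by exists x; apply: (lfp_rule _ H1 H2); exists k, (enc_a e1), (enc_a e2), l, x1, x2, x.
elim: e => [q|v|a IHa b IHb|a IHa b IHb|a IHa b IHb|a IHa b IHb] /=.
- by exists (encq q); apply: lfp_ax; left; exists (encq q), l.
- have [x Hx] := lookup_total v V.
  by exists x; apply: lfp_ax; right; exists v, l, x.
- exact: (@bin 0).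
- exact: (@bin 1).
- exact: (@bin 2).
- exact: (@bin 3).
Qed.

(** Truth values are 0 and 1 and connectives are polynomial equations between them, so [BNot] needs
    no negated derivability. *)
Definition beval_graph := lfp
  (fun z => (exists l, z = pr (pr 0 0) (pr l 1)) \/ (exists l, z = pr (pr 1 0) (pr l 0)) \/
    (exists k e1 e2 l x1 x2 t, aeval_graph (pr e1 (pr l x1)) /\
       aeval_graph (pr e2 (pr l x2)) /\ k <= 2 /\ rcmp k x1 x2 t /\
       z = pr (pr k.+2 (pr e1 e2)) (pr l t)))
  (fun z a b => (exists e l t u, t + u = 1 /\ a = pr e (pr l t) /\ b = a /\
       z = pr (pr 5 e) (pr l u)) \/
    (exists e1 e2 l t1 t2, a = pr e1 (pr l t1) /\ b = pr e2 (pr l t2) /\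
       z = pr (pr 6 (pr e1 e2)) (pr l (t1 * t2))) \/
    (exists e1 e2 l t1 t2 t, a = pr e1 (pr l t1) /\ b = pr e2 (pr l t2) /\
       t + t1 * t2 = t1 + t2 /\ z = pr (pr 7 (pr e1 e2)) (pr l t))).

Lemma sigma1_beval_graph : Sigma1 (fun e => beval_graph (e 0)).
Proof. by apply: sigma1_lfp; rewrite /rcmp /rle /rlt; sigma. Qed.
#[local] Hint Resolve sigma1_beval_graph : sigma.

Lemma beval_sound e l t eta :
  beval_graph (pr (enc_b e) (pr l t)) -> codes_val l eta -> t = beval eta e.
Proof.
move E: (pr _ _) => z H; elim: H e l t eta E => {z} [z|z a b].
  case=> [[l' ->]|[[l' ->]|]].
  - by move=> e l t eta E V; prinv; destruct e; simpl in *; prinv.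
  - by move=> e l t eta E V; prinv; destruct e; simpl in *; prinv.
  move=> [k [e1 [e2 [l' [x1 [x2 [t' [H1 [H2 [k2 [H ->]]]]]]]]]]] e l t eta E V; prinv.
  have sem f1 f2 : e1 = enc_a f1 -> e2 = enc_a f2 ->
      t' = ratcmp k (aeval eta f1) (aeval eta f2).
    by move=> *; subst; apply/(rcmpP _ k2 (aeval_sound H1 V) (aeval_sound H2 V)).
  by destruct e; simpl in *; prinv; apply: sem.
case=> [[e' [l' [t' [u [tu [-> [-> ->]]]]]]]|[]].
- move=> _ IH _ _ e l t eta E V; prinv; destruct e; simpl in *; prinv.
  by have := IH _ _ _ _ erefl V; case: (beval eta e) => /=; lia.
- move=> [e1 [e2 [l' [t1 [t2 [-> [-> ->]]]]]]] _ IHa _ IHb e l t eta E V; prinv.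
  destruct e; simpl in *; prinv.
  by rewrite (IHa _ _ _ _ erefl V) (IHb _ _ _ _ erefl V) mulnb.
- move=> [e1 [e2 [l' [t1 [t2 [u [-> [-> [H ->]]]]]]]]] _ IHa _ IHb e l t eta E V; prinv.
  destruct e; simpl in *; prinv.
  have := IHa _ _ _ _ erefl V; have := IHb _ _ _ _ erefl V.
  by do 2!case: (beval _ _) => /=; lia.
Qed.

Lemma beval_complete e l eta : codes_val l eta ->
  beval_graph (pr (enc_b e) (pr l (beval eta e))).
Proof.
move=> V; have cmp k e1 e2 : k <= 2 -> beval_graph
    (pr (pr k.+2 (pr (enc_a e1) (enc_a e2))) (pr l (ratcmp k (aeval eta e1) (aeval eta e2)))).
  move=> k2; have [x1 H1] := aeval_total e1 V; have [x2 H2] := aeval_total e2 V.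
  apply: lfp_ax; right; right; do 4!eexists; exists x1, x2; eexists.
  split; first exact: H1; split; first exact: H2; split; first exact: k2; split=> //.
  exact/(rcmpP _ k2 (aeval_sound H1 V) (aeval_sound H2 V)).
elim: e => [||a b|a b|a b|b IHb|a IHa b IHb|a IHa b IHb] /=.
- by apply: lfp_ax; left; exists l.
- by apply: lfp_ax; right; left; exists l.
- exact: (@cmp 0).
- exact: (@cmp 1).
- exact: (@cmp 2).
- apply: (lfp_rule _ IHb IHb); left; exists (enc_b b), l, (beval eta b), (~~ beval eta b).
  by case: (beval eta b).
- apply: (lfp_rule _ IHa IHb); right; left.
  by exists (enc_b a), (enc_b b), l, (beval eta a), (beval eta b); rewrite mulnb.
- apply: (lfp_rule _ IHa IHb); right; right.
  exists (enc_b a), (enc_b b), l, (beval eta a), (beval eta b), (beval eta a || beval eta b).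
  by do !split=> //; case: (beval eta a) (beval eta b) => -[].
Qed.

(** The rules of [guarantee] on codes of a stack of programs, a valuation and a bound; 0 is the
    empty stack and a successor of a pair pushes a program. Branches of a nondeterministic choice
    may deliver different codes of one bound, so that rule compares by [rle] instead of asking for
    equal codes. *)
Definition guarantee_graph := lfp
  (fun z => (exists s l, z = pr s (pr l code0)) \/
    (exists l, z = pr (pr (pr 0 0) 0).+1 (pr l code1)))
  (fun z a b =>
    (exists s l x y, rle x y /\ a = pr s (pr l y) /\ b = a /\ z = pr s (pr l x)) \/
    (exists p s l x, a = pr (pr p s).+1 (pr l x) /\ b = a /\
       z = pr (pr (pr 0 0) (pr p s).+1).+1 (pr l x)) \/
    (exists v e s l y x, aeval_graph (pr e (pr l y)) /\
       a = pr (pr (pr 0 0) s).+1 (pr (pr (pr v y) l).+1 x) /\ b = a /\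
       z = pr (pr (pr 1 (pr v e)) s).+1 (pr l x)) \/
    (exists p p' s l x, a = pr (pr p (pr p' s).+1).+1 (pr l x) /\ b = a /\
       z = pr (pr (pr 2 (pr p p')) s).+1 (pr l x)) \/
    (exists p e p' s l r x, aeval_graph (pr e (pr l r)) /\ rle r code0 /\
       a = pr (pr p' s).+1 (pr l x) /\ b = a /\
       z = pr (pr (pr 3 (pr p (pr e p'))) s).+1 (pr l x)) \/
    (exists p e p' s l r x, aeval_graph (pr e (pr l r)) /\ rle code1 r /\
       a = pr (pr p s).+1 (pr l x) /\ b = a /\
       z = pr (pr (pr 3 (pr p (pr e p'))) s).+1 (pr l x)) \/
    (exists p e p' s l r r' x1 x2 y1 y2 x, aeval_graph (pr e (pr l r)) /\
       rlt code0 r /\ rlt r code1 /\ rop 2 r x1 y1 /\ rop 1 code1 r r' /\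
       rop 2 r' x2 y2 /\ rop 0 y1 y2 x /\
       a = pr (pr p s).+1 (pr l x1) /\ b = pr (pr p' s).+1 (pr l x2) /\
       z = pr (pr (pr 3 (pr p (pr e p'))) s).+1 (pr l x)) \/
    (exists p p' s l x1 x2 x, rle x x1 /\ rle x x2 /\ a = pr (pr p s).+1 (pr l x1) /\
       b = pr (pr p' s).+1 (pr l x2) /\ z = pr (pr (pr 4 (pr p p')) s).+1 (pr l x)) \/
    (exists e p s l x, beval_graph (pr e (pr l 1)) /\
       a = pr (pr p (pr (pr 5 (pr e p)) s).+1).+1 (pr l x) /\ b = a /\
       z = pr (pr (pr 5 (pr e p)) s).+1 (pr l x)) \/
    (exists e p s l x, beval_graph (pr e (pr l 0)) /\
       a = pr (pr (pr 0 0) s).+1 (pr l x) /\ b = a /\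
       z = pr (pr (pr 5 (pr e p)) s).+1 (pr l x))).

Lemma sigma1_guarantee_graph : Sigma1 (fun e => guarantee_graph (e 0)).
Proof. by apply: sigma1_lfp; rewrite /rop /rle /rlt; sigma. Qed.
#[local] Hint Resolve sigma1_guarantee_graph : sigma.

Definition enc_s (K : seq prog) := foldr (fun P s => (pr (enc_p P) s).+1) 0 K.

Lemma enc_sE P K : enc_s (P :: K) = (pr (enc_p P) (enc_s K)).+1.
Proof. by []. Qed.

Lemma codes_rat_total q : exists x, codes_rat x q.
Proof. by exists (encq q); exact: codes_rat_enc. Qed.

Lemma guarantee_graph_sound P K l x eta : guarantee_graph (pr (enc_s (P :: K)) (pr l x)) ->
  codes_val l eta -> exists q, codes_rat x q /\ guarantee P K eta q.
Proof.
move E: (pr _ _) => z H; elim: H P K l x eta E => {z} [z|z a b].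
  case=> [[s [l' ->]]|[l' ->]] P K l x eta E V.
    by exists 0%R; prinv; split; [exact: codes_rat0|exact: guarantee_zero].
  rewrite enc_sE in E; prinv.
  destruct P; simpl in *; prinv; destruct K; simpl in *; prinv.
  by exists 1%R; split; [exact: codes_rat1|exact: guarantee_end].
move=> rules _ IHa _ IHb P K l x eta E V; rewrite enc_sE in E; move: rules.
case=> [[s [l' [x' [y [le [Ea [Eb Ez]]]]]]]|].
  prinv; have [r [Hy HT]] := IHa P K _ _ _ erefl V.
  (* [rle] relates only codes of fractions, so the weakened bound does denote a rational. *)
  case: (le) => [a1 [b1 [c1 [_ [_ [_ [Ex _]]]]]]]; rewrite Ex in le *.
  have Hx : codes_rat (pr (pr a1 b1) c1) ((a1%:R - b1%:R) / c1.+1%:R)%R by exists a1, b1, c1.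
  eexists; split; first exact: Hx.
  by apply: guarantee_weak HT; apply/(rleP Hx Hy).
case=> [[p [s [l' [x' [Ea [Eb Ez]]]]]]|].
  rewrite Ea in IHa; prinv; destruct P; simpl in *; prinv.
  destruct K as [|Q K]; simpl in *; prinv.
  by have [q [Hq T]] := IHa Q K _ _ _ erefl V; exists q; split=> //; apply: guarantee_bot.
case=> [[v [e [s [l' [y [x' [Hy [Ea [Eb Ez]]]]]]]]]|].
  rewrite Ea in IHa; prinv; destruct P; simpl in *; prinv.
  have V' := codes_val_cons _ V (aeval_sound Hy V).
  have [q [Hq T]] := IHa Bot K _ _ _ erefl (V' _).
  by exists q; split=> //; apply: guarantee_assign.
case=> [[p [p' [s [l' [x' [Ea [Eb Ez]]]]]]]|].
  rewrite Ea in IHa; prinv; destruct P as [| |P1 P2| | |]; simpl in *; prinv.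
  have [q [Hq T]] := IHa P1 (P2 :: K) _ _ _ erefl V.
  by exists q; split=> //; apply: guarantee_seq.
case=> [[p [e [p' [s [l' [r [x' [Hr [le [Ea [Eb Ez]]]]]]]]]]]|].
  rewrite Ea in IHa; prinv; destruct P as [| | |P1 ep P2| |]; simpl in *; prinv.
  have [q [Hq T]] := IHa P2 K _ _ _ erefl V.
  exists q; split=> //; apply: guarantee_prob_le0 => //.
  exact/(rleP (aeval_sound Hr V) codes_rat0).
case=> [[p [e [p' [s [l' [r [x' [Hr [le [Ea [Eb Ez]]]]]]]]]]]|].
  rewrite Ea in IHa; prinv; destruct P as [| | |P1 ep P2| |]; simpl in *; prinv.
  have [q [Hq T]] := IHa P1 K _ _ _ erefl V.
  exists q; split=> //; apply: guarantee_prob_ge1 => //.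
  exact/(rleP codes_rat1 (aeval_sound Hr V)).
case=> [[p [e [p' [s [l' [r [r' [x1 [x2 [y1 [y2 [x' [Hr [lt0 [lt1
    [R1 [R2 [R3 [R4 [Ea [Eb Ez]]]]]]]]]]]]]]]]]]]]]|].
  rewrite Ea in IHa; rewrite Eb in IHb; prinv.
  destruct P as [| | |P1 ep P2| |]; simpl in *; prinv.
  have [q1 [Hq1 T1]] := IHa P1 K _ _ _ erefl V.
  have [q2 [Hq2 T2]] := IHb P2 K _ _ _ erefl V.
  have Hp := aeval_sound Hr V.
  exists (aeval eta ep * q1 + (1 - aeval eta ep) * q2)%R; split.
    apply: (rop_sound R4 (rop_sound R1 Hp Hq1) (rop_sound R3 _ Hq2)).
    exact: (rop_sound R2 codes_rat1 Hp).
  apply: guarantee_prob => //; apply/andP; split.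
    exact/(rltP codes_rat0 Hp).
  exact/(rltP Hp codes_rat1).
case=> [[p [p' [s [l' [x1 [x2 [x' [le1 [le2 [Ea [Eb Ez]]]]]]]]]]]|].
  rewrite Ea in IHa; rewrite Eb in IHb; prinv.
  destruct P as [| | | |P1 P2|]; simpl in *; prinv.
  have [q1 [Hq1 T1]] := IHa P1 K _ _ _ erefl V.
  have [q2 [Hq2 T2]] := IHb P2 K _ _ _ erefl V.
  case: (le1) => [a1 [b1 [c1 [_ [_ [_ [Ex _]]]]]]]; rewrite Ex in le1 le2 *.
  have Hx : codes_rat (pr (pr a1 b1) c1) ((a1%:R - b1%:R) / c1.+1%:R)%R by exists a1, b1, c1.
  eexists; split; first exact: Hx.
  by apply: guarantee_nd; [apply: guarantee_weak T1; apply/(rleP Hx Hq1)|apply: guarantee_weak T2; apply/(rleP Hx Hq2)].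
case=> [[e [p [s [l' [x' [Hb [Ea [Eb Ez]]]]]]]]|].
  rewrite Ea in IHa; prinv; destruct P as [| | | | |be P1]; simpl in *; prinv.
  have [q [Hq T]] := IHa P1 (While be P1 :: K) _ _ _ erefl V.
  exists q; split=> //; apply: guarantee_while_true => //.
  by have := beval_sound Hb V; case: (beval _ _).
case=> [e [p [s [l' [x' [Hb [Ea [Eb Ez]]]]]]]].
rewrite Ea in IHa; prinv; destruct P as [| | | | |be P1]; simpl in *; prinv.
have [q [Hq T]] := IHa Bot K _ _ _ erefl V.
exists q; split=> //; apply: guarantee_while_false => //.
by have := beval_sound Hb V; case: (beval _ _).
Qed.

Lemma guarantee_graph_complete P K eta q l : guarantee P K eta q -> codes_val l eta ->
  exists x, codes_rat x q /\ guarantee_graph (pr (enc_s (P :: K)) (pr l x)).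
Proof.
move=> T; elim: T l => {P K eta q}.
- move=> P K eta l V; exists code0; split; first exact: codes_rat0.
  by apply: lfp_ax; left; exists (enc_s (P :: K)), l.
- move=> P K eta q r qr _ IH l V; have [y [Hy H]] := IH l V.
  have [x Hx] := codes_rat_total q; exists x; split=> //; apply: (lfp_rule _ H H).
  by left; do 3!eexists; exists y; split; [exact/(rleP Hx Hy)|].
- move=> eta l V; exists code1; split; first exact: codes_rat1.
  by apply: lfp_ax; right; exists l.
- move=> P K eta q _ IH l V; have [x [Hx H]] := IH l V; exists x; split=> //.
  by apply: (lfp_rule _ H H); do 1!right; left; exists (enc_p P), (enc_s K), l, x.
- move=> v e K eta q _ IH l V; have [y Hy] := aeval_total e V.
  have [x [Hx H]] := IH _ (codes_val_cons v V (aeval_sound Hy V)); exists x; split=> //.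
  apply: (lfp_rule _ H H); do 2!right; left; exists v, (enc_a e), (enc_s K), l, y, x.
  by split.
- move=> P Q K eta q _ IH l V; have [x [Hx H]] := IH l V; exists x; split=> //.
  by apply: (lfp_rule _ H H); do 3!right; left; exists (enc_p P), (enc_p Q), (enc_s K), l, x.
- move=> P p Q K eta q p0 _ IH l V; have [x [Hx H]] := IH l V; exists x; split=> //.
  have [r Hr] := aeval_total p V; apply: (lfp_rule _ H H); do 4!right; left.
  exists (enc_p P), (enc_a p), (enc_p Q), (enc_s K), l, r, x; split=> //; split=> //.
  exact/(rleP (aeval_sound Hr V) codes_rat0).
- move=> P p Q K eta q p1 _ IH l V; have [x [Hx H]] := IH l V; exists x; split=> //.
  have [r Hr] := aeval_total p V; apply: (lfp_rule _ H H); do 5!right; left.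
  exists (enc_p P), (enc_a p), (enc_p Q), (enc_s K), l, r, x; split=> //; split=> //.
  exact/(rleP codes_rat1 (aeval_sound Hr V)).
- move=> P p Q K eta q1 q2 /andP[p0 p1] _ IH1 _ IH2 l V.
  have [x1 [Hx1 H1]] := IH1 l V; have [x2 [Hx2 H2]] := IH2 l V.
  have [r Hr] := aeval_total p V; have Rr := aeval_sound Hr V.
  have [y1 R1] := @rop_total 2 _ _ _ _ isT Rr Hx1; have Hy1 := rop_sound R1 Rr Hx1.
  have [r' R2] := @rop_total 1 _ _ _ _ isT codes_rat1 Rr; have Rr' := rop_sound R2 codes_rat1 Rr.
  have [y2 R3] := @rop_total 2 _ _ _ _ isT Rr' Hx2; have Hy2 := rop_sound R3 Rr' Hx2.
  have [x R4] := @rop_total 0 _ _ _ _ isT Hy1 Hy2.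
  exists x; split; first exact: (rop_sound R4 Hy1 Hy2).
  apply: (lfp_rule _ H1 H2); do 6!right; left.
  exists (enc_p P), (enc_a p), (enc_p Q), (enc_s K), l, r, r', x1, x2, y1, y2, x.
  split=> //; split; first exact/(rltP codes_rat0 Rr).
  by split; first exact/(rltP Rr codes_rat1).
- move=> P Q K eta q _ IH1 _ IH2 l V.
  have [x1 [Hx1 H1]] := IH1 l V; have [x2 [Hx2 H2]] := IH2 l V.
  (* [x1] and [x2] both code [q], so [x1] lies below both. *)
  exists x1; split=> //; apply: (lfp_rule _ H1 H2); do 7!right; left.
  exists (enc_p P), (enc_p Q), (enc_s K), l, x1, x2, x1.
  by split; [exact/(rleP Hx1 Hx1)|split; [exact/(rleP Hx1 Hx2)|]].
- move=> b P K eta q hb _ IH l V; have [x [Hx H]] := IH l V; exists x; split=> //.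
  apply: (lfp_rule _ H H); do 8!right; left; exists (enc_b b), (enc_p P), (enc_s K), l, x.
  by split=> //; have := beval_complete b V; rewrite hb.
- move=> b P K eta q hb _ IH l V; have [x [Hx H]] := IH l V; exists x; split=> //.
  apply: (lfp_rule _ H H); do 9!right; exists (enc_b b), (enc_p P), (enc_s K), l, x.
  by split=> //; have := beval_complete b V; rewrite (negbTE hb).
Qed.

(** * Injectivity of the program code and the final formula *)

Lemma enc_aexp_inj : injective enc_aexp.
Proof.
by elim=> [q|v|a IHa b IHb|a IHa b IHb|a IHa b IHb|a IHa b IHb]
  [q'|v'|a' b'|a' b'|a' b'|a' b'] //= [] => [->|->|/IHa-> /IHb->|/IHa-> /IHb->
  |/IHa-> /IHb->|/IHa-> /IHb->].
Qed.

Lemma enc_bexp_inj : injective enc_bexp.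
Proof.
elim=> [||a b|a b|a b|b IHb|a IHa b IHb|a IHa b IHb]
  [||a' b'|a' b'|a' b'|b'|a' b'|a' b'] //= [].
- by move=> /enc_aexp_inj-> /enc_aexp_inj->.
- by move=> /enc_aexp_inj-> /enc_aexp_inj->.
- by move=> /enc_aexp_inj-> /enc_aexp_inj->.
- by move=> /IHb->.
- by move=> /IHa-> /IHb->.
- by move=> /IHa-> /IHb->.
Qed.

Lemma enc_prog_inj : injective enc_prog.
Proof.
elim=> [|v e|P IHP Q IHQ|P IHP p Q IHQ|P IHP Q IHQ|b P IHP]
  [|v' e'|P' Q'|P' p' Q'|P' Q'|b' P'] //= [].
- by move=> -> /enc_aexp_inj->.
- by move=> /IHP-> /IHQ->.
- by move=> /IHP-> /enc_aexp_inj-> /IHQ->.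
- by move=> /IHP-> /IHQ->.
- by move=> /enc_bexp_inj-> /IHP->.
Qed.

Lemma code_inj : injective code.
Proof. by move=> P Q /(pcan_inj pickleK)/enc_prog_inj. Qed.

(** [pr (pr k 0) k] codes k/(k+1), that is 1 - 1/(k+1); the tail 0 says that [n] is the complete
    token list. *)
Definition almost_surely_up_to n k := exists p x,
  tokens_p (pr p (pr 0 n)) /\ guarantee_graph (pr (pr p 0).+1 (pr 0 x)) /\
  rle (pr (pr k 0) k) x.

Lemma almost_surely_up_toP n k : almost_surely_up_to n k <->
  exists P, code P = n /\ exists2 q : rat, (1 - k.+1%:R^-1 <= q)%R & guarantee P [::] eta0 q.
Proof.
have Hk : codes_rat (pr (pr k 0) k) (1 - k.+1%:R^-1)%R.
  have nz : (k.+1%:R : rat) != 0%R by rewrite pnatr_eq0.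
  exists k, 0, k; split=> //; apply: (mulIf nz).
  by rewrite subr0 mulrBl mul1r mulVf // mulfVK // -natr1 addrK.
split=> [[p [x [/tokens_pP[P [-> ->]] [H le]]]]|[P [<- [q kq T]]]].
  have [q [Hq T]] := @guarantee_graph_sound P [::] 0 x eta0 H codes_val_nil.
  exists P; split; first by rewrite code_tokens.
  by exists q => //; apply/(rleP Hk Hq).
have [x [Hx H]] := guarantee_graph_complete T codes_val_nil.
exists (enc_p P), x; split; first by apply/tokens_pP; exists P; rewrite code_tokens.
by split=> //; apply/(rleP Hk Hx).
Qed.

(** Every k supplies its own program with code [n]; injectivity makes them one. The instance k = 0
    already ensures that [n] is a code. *)
Lemma AST_iff n : AST n <-> forall k, almost_surely_up_to n k.
Proof.
split=> [[P [<- /AST_prog_iff H]] k|H].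
  by apply/almost_surely_up_toP; exists P; split.
have /almost_surely_up_toP[P [EP _]] := H 0; exists P; split=> //.
apply/AST_prog_iff => k; have /almost_surely_up_toP[Q [EQ HQ]] := H k.
by rewrite (code_inj (etrans EP (esym EQ))).
Qed.

Theorem theoremB4 : Pi02 AST.
Proof.
(* Index 0 is the universally quantified k and index 1 is n; the Sigma_1 witness is put in front of
   them, which is the order of variables in [Pi02]. *)
have [Q [phi phiP] QE] : Sigma1 (fun e => almost_surely_up_to (e 1) (e 0)).
  by rewrite /almost_surely_up_to /rle; sigma.
exists phi => n; rewrite AST_iff; split=> H x.
  have /(QE (scons x (scons n (fun _ => 0))))[y Hy] := H x.
  by exists y; apply/phiP.
apply/(QE (scons x (scons n (fun _ => 0)))); have [y Hy] := H x.
by exists y; apply/(phiP (scons y (scons x (scons n (fun _ => 0))))).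
Qed.
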